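(* Let $W\subseteq\mathbb{R}^n$ be an affine subspace containing an integral point (i.e. $W\cap\mathbb{Z}^n\neq\emptyset$), and let $V$ be the affine hull of $W\cap\mathbb{Z}^n$. A set $S\subseteq W$ is a maximal lattice-free convex set of $W$ if and only if one of the following holds: (i) $S$ is a polyhedron in $W$ with $\dim(S)=\dim(W)$, $S\cap V$ is a maximal lattice-free convex set of $V$ with $\dim(S\cap V)=\dim(V)$, the facets of $S$ and the facets of $S\cap V$ are in one-to-one correspondence, and for every facet $F$ of $S$, $F\cap V$ is the facet of $S\cap V$ corresponding to $F$; (ii) $S$ is an affine hyperplane of $W$ of the form $S=v+L$, where $v\in S$, $L$ is a linear subspace, and, denoting by $V_0=\{x-y : x,y\in V\}$ the linear space parallel to $V$, $L\cap V_0$ is an irrational linear hyperplane of $V_0$ (that is, $L\cap V_0$ has dimension $\dim(V_0)-1$ and is not linearly spanned by the integral vectors it contains); (iii) $S$ is a closed half-space of $W$ that contains $V$ on its boundary.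
   Context: For an affine subspace $U$ of $\mathbb{R}^n$ containing an integral point (a point of $\mathbb{Z}^n$), a set $B$ is a maximal lattice-free convex set in (of) $U$ if $B\subseteq U$, $B$ is convex, $B$ has no integral point in its interior with respect to the topology induced on $U$ by $\mathbb{R}^n$, and $B$ is inclusionwise maximal with these three properties. (Thus $B$ is allowed to have dimension strictly less than $\dim U$, in which case its interior in $U$ is empty.) This notion is applied both with $U=W$ and with $U=V$. A half-space of $W$ is one of the two closed sides of an affine hyperplane of $W$.
   Formalization: When W is a single (integral) point, S is assumed nonempty: for W={w} and S empty, S is literally a maximal lattice-free convex set of W, but none of (i), (ii), (iii) holds. *)

(* Defs.v *)
From HB Require Import structures.
From mathcomp Require Import all_boot all_order all_algebra.
From mathcomp Require Import all_classical all_reals all_analysis.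

Set Implicit Arguments.
Unset Strict Implicit.
Unset Printing Implicit Defensive.

Import Order.TTheory GRing.Theory Num.Theory.
Import numFieldNormedType.Exports.

Local Open Scope classical_set_scope.
Local Open Scope ring_scope.

Section Defs.
Context {R : realType} {n : nat}.
Local Notation E := 'rV[R]_n.
Implicit Types (U V W S B F H : set E) (L : {vspace E}).

Definition dot (a x : E) : R := \sum_i a 0 i * x 0 i.

Definition integral_points : set E := [set x | forall i, x 0 i \is a Num.int].

Definition translate (v : E) L : set E := [set v + y | y in [set` L]].

Definition affine_subspace U := exists v L, U = translate v L.

(* The affine hull of the empty set is empty. *)
Definition affine_hull B : set E :=
  [set x | exists k (c : 'I_k -> R) (p : 'I_k -> E),
    [/\ forall i, B (p i), \sum_i c i = 1 & x = \sum_i c i *: p i]].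

Definition linear_span B : set E :=
  [set x | exists k (c : 'I_k -> R) (p : 'I_k -> E),
    (forall i, B (p i)) /\ x = \sum_i c i *: p i].

(* The affine dimension is relational: the empty set, conventionally of
   dimension -1, has no [d : nat] as a dimension. *)
Definition has_dim B (d : nat) :=
  exists v L, affine_hull B = translate v L /\ \dim L = d.

(* The topology of [subspace U] also has isolated points outside [U]; they play
   no role below, where only subsets of [U] are considered. *)
Definition interior_in U B : set E := interior (B : set (subspace U)).

Definition boundary_in U B : set E :=
  closure (B : set (subspace U)) `\` interior_in U B.

Definition lattice_free_convex U B :=
  [/\ B `<=` U, convex_set B & interior_in U B `&` integral_points = set0].

Definition maximal_lattice_free_convex U B :=
  lattice_free_convex U B /\
  forall B', lattice_free_convex U B' -> B `<=` B' -> B' = B.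

Definition polyhedron_in W S :=
  exists m (a : 'I_m -> E) (b : 'I_m -> R),
    S = W `&` [set x | forall i, dot (a i) x <= b i].

Definition face S F :=
  exists (a : E) (c : R),
    (forall x, S x -> dot a x <= c) /\ F = S `&` [set x | dot a x = c].

Definition facets S : set (set E) :=
  [set F | face S F /\ exists d, has_dim S d.+1 /\ has_dim F d].

Definition affine_hyperplane_of W H :=
  [/\ affine_subspace H, H `<=` W
    & exists d, has_dim W d.+1 /\ has_dim H d].

(* The other closed side of the hyperplane is obtained from [- a] and [- c]. *)
Definition closed_half_space_of W S :=
  exists (a : E) (c : R),
    affine_hyperplane_of W (W `&` [set x | dot a x = c]) /\
    S = W `&` [set x | dot a x <= c].

Definition irrational_hyperplane_of (V0 L : {vspace E}) :=
  [/\ (L <= V0)%VS, (\dim L).+1 = \dim V0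
    & [set` L] <> linear_span ([set` L] `&` integral_points)].

End Defs.

(* Main.v *)
(* If the interior of [S] in [W] is empty, [S] is a hyperplane {f = c} of [W]:
   if [f] were constant on [V], or if its kernel in the direction of [V] were spanned
   by lattice vectors, then [S] could be thickened to a half-space or to a slab; in
   the irrational case the values of [f] at integral points are dense, so that nothing
   larger is lattice-free. If the interior of [S] is nonempty but misses [V], then
   separating it from [V] puts [S] in a half-space bounded by a hyperplane through [V].

   Otherwise [C = S `&` V] is maximal in [V], since a convex [C'] between [C] and [V]
   satisfies conv(S, C') `&` V = C'. Separating each integral point [z] from the
   interior of [S] gives half-spaces H_z of [W] whose traces on [V] intersect in [C].
   Finitely many suffice: the recession cone of [C] is a linear space because some
   multiple of any direction of [V] is close to a lattice vector, and by compactness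
   finitely many H_z cut out a set bounded modulo that space. The integral points of
   this set have finitely many classes, as otherwise the differences of close classes
   would produce, in the limit, a new line in the recession cone of [C]. An
   irredundant choice of the H_z describes both [C] in [V] and [S] in [W], whence the
   correspondence of facets. Conversely, if [p] violates the facet inequality of [F],
   a relative interior point of [F `&` V] is interior to conv(S, p); this forbids
   lattice-free extensions of [S] when [S `&` V] is maximal. *)
Require Import Defs.
From HB Require Import structures.
From mathcomp Require Import all_boot all_order all_algebra.
From mathcomp Require Import all_classical all_reals all_analysis.
From mathcomp Require Import ring lra.

Import Order.TTheory GRing.Theory Num.Theory.
Import numFieldNormedType.Exports.

Set Implicit Arguments.
Unset Strict Implicit.
Unset Printing Implicit Defensive.

Local Open Scope classical_set_scope.
Local Open Scope ring_scope.

Ltac vec := apply/rowP => ?; rewrite ?mxE; ring.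

(** * Affine geometry *)

Section LinearAlgebra.
Context {R : realType} {n : nat}.
Local Notation E := 'rV[R]_n.
Implicit Types (a u v w x y : E) (L : {vspace E}) (c t : R) (B : set E).

Lemma dotDr a x y : dot a (x + y) = dot a x + dot a y.
Proof. by rewrite /dot -big_split; apply: eq_bigr => i _; rewrite mxE mulrDr. Qed.

Lemma dotZr a c x : dot a (c *: x) = c * dot a x.
Proof. by rewrite /dot big_distrr; apply: eq_bigr => i _; rewrite mxE mulrCA. Qed.

Lemma dotNr a x : dot a (- x) = - dot a x.
Proof. by rewrite -scaleN1r dotZr mulN1r. Qed.

Lemma dotBr a x y : dot a (x - y) = dot a x - dot a y.
Proof. by rewrite dotDr dotNr. Qed.

Lemma dot0r a : dot a 0 = 0.
Proof. by rewrite -(scale0r 0) dotZr mul0r. Qed.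

Lemma dotNl a x : dot (- a) x = - dot a x.
Proof. by rewrite /dot -sumrN; apply: eq_bigr => i _; rewrite mxE mulNr. Qed.

Lemma dot_sumr a (I : Type) (r : seq I) (P : pred I) (F : I -> E) :
  dot a (\sum_(i <- r | P i) F i) = \sum_(i <- r | P i) dot a (F i).
Proof. by apply: (big_morph _ (dotDr a) (dot0r a)). Qed.

Definition dotE := (dotDr, dotBr, dotNr, dotZr, dot0r).

Lemma coord_le_norm x i : `|x 0 i| <= `|x|.
Proof.
rewrite [leRHS](_ : _ = mx_norm x)// mx_normrE; apply/bigmax_geP; right => /=.
by exists (ord0, i).
Qed.

Lemma norm_ltP x c : 0 < c -> (forall i, `|x 0 i| < c) -> `|x| < c.
Proof.
move=> c0 h; rewrite (_ : `|x| = mx_norm x)// mx_normrE; apply/bigmax_ltP; split => //=.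
by move=> [i j] _ /=; rewrite ord1.
Qed.

Lemma dot_le_norm a x : `|dot a x| <= (\sum_i `|a 0 i|) * `|x|.
Proof.
apply: le_trans (ler_norm_sum _ _ _) _; rewrite mulr_suml; apply: ler_sum => i _.
by rewrite normrM ler_wpM2l// coord_le_norm.
Qed.

Lemma functional_dot (f : {linear E -> R^o}) : exists a, forall x, f x = dot a x.
Proof.
exists (\row_j f (delta_mx 0 j)) => x.
rewrite {1}[x]row_sum_delta linear_sum /dot; apply: eq_bigr => i _.
by rewrite linearZ mxE /= mulrC.
Qed.

Lemma linear_bounded (p : 'End(E)) : exists2 K : R, 0 < K & forall x, `|p x| <= K * `|x|.
Proof.
exists (1 + \sum_j `|p (delta_mx 0 j)|) => [|x].
  by rewrite ltr_pwDl// sumr_ge0.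
rewrite {1}[x]row_sum_delta linear_sum /=; apply: le_trans (ler_norm_sum _ _ _) _.
rewrite mulrDl mul1r mulr_suml ler_wpDl//; apply: ler_sum => i _.
by rewrite linearZ normrZ mulrC ler_wpM2l// coord_le_norm.
Qed.

(** The map [q = \1 - projv L] has kernel [L], so some coordinate of [q u] is nonzero; that
    coordinate of [q], rescaled, is the functional. *)
Lemma separating_functional L u : u \notin L ->
  exists a, (forall x, x \in L -> dot a x = 0) /\ dot a u = 1.
Proof.
move=> uL; pose q : 'End(E) := (\1 - projv L)%VF.
have qE x : q x = x - projv L x by rewrite /q add_lfunE opp_lfunE id_lfunE.
have qu0 : q u != 0.
  by rewrite qE subr_eq0; apply: contra uL => /eqP ->; exact: memv_proj.
have [i qi] : exists i, q u 0 i != 0.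
  apply: contrapT => /forallNP h; move/eqP: qu0; apply; apply/rowP => i.
  by rewrite mxE; apply/eqP; apply: contrapT => /negP; exact: h.
pose f (x : E) : R^o := (q u 0 i)^-1 * q x 0 i.
have fl : linear f.
  by move=> c x y; rewrite /f linearP !mxE /= /GRing.scale /=; ring.
pose F : {linear E -> R^o} := HB.pack f (GRing.isLinear.Build _ _ _ _ f fl).
have [a aE] := functional_dot F; exists a; split => [x xL|].
  by rewrite -aE /= /f; have -> : q x = 0; [rewrite qE projv_id// subrr|rewrite mxE mulr0].
by rewrite -aE /= /f mulVf.
Qed.

Lemma span_coordP (X : seq E) x : x \in <<X>>%VS ->
  exists c : 'I_(size X) -> R, x = \sum_i c i *: X`_i.
Proof.
move=> xX; exists (fun i => coord (in_tuple X) i x).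
exact: (@coord_span _ _ _ (in_tuple X) x xX).
Qed.

Lemma span_comb (X : seq E) (c : 'I_(size X) -> R) :
  \sum_i c i *: X`_i \in <<X>>%VS.
Proof. by apply: memv_suml => i _; rewrite memvZ// memv_span// mem_nth. Qed.

(** A list of elements of [B] that does not generate [B] can be prolonged so that the dimension of
    its span grows, and this dimension is bounded by that of the whole space. *)
Lemma finite_generation B : exists X : seq E,
  (forall x, x \in X -> B x) /\ (forall x, B x -> x \in <<X>>%VS).
Proof.
suff h k : (exists X : seq E, (forall x, x \in X -> B x) /\
    (forall x, B x -> x \in <<X>>%VS)) \/
    exists X : seq E, (forall x, x \in X -> B x) /\ (k <= \dim <<X>>)%N.
  have [//|[X [_]]] := h (\dim {:E}).+1.
  by rewrite ltnNge dimvS// subvf.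
elim: k => [|k [|[X [XB kX]]]]; [by right; exists [::] | by left |].
have [|/existsNP[x /not_implyP[Bx /negP xX]]] :=
  pselect (forall x, B x -> x \in <<X>>%VS); first by left; exists X.
right; exists (x :: X); split => [y|].
  by rewrite inE => /predU1P[->|/XB].
apply: leq_ltn_trans kX _.
have sX : (<<X>> <= <<x :: X>>)%VS by rewrite span_cons addvSr.
rewrite (ltn_leqif (dimv_leqif_sup sX)); apply: contra xX => /subvP; apply.
by rewrite memv_span// inE eqxx.
Qed.

Lemma subspace_vspace B : B 0 -> (forall c x y, B x -> B y -> B (c *: x + y)) ->
  exists L, forall x, x \in L <-> B x.
Proof.
move=> B0 BZD; have [X [XB BX]] := finite_generation B.
exists <<X>>%VS => x; split=> [/span_coordP[c ->]|/BX//].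
by elim/big_ind: _ => // [y z By Bz|i _];
  [rewrite -[y]scale1r; exact: BZD | rewrite -[_ *: _]addr0; apply: BZD => //; apply/XB/mem_nth].
Qed.

(** Rank-nullity on [L]: the image of [L] under [dot a] is nonzero, hence of dimension 1. *)
Lemma hyperplane_dim L a : (exists2 u, u \in L & dot a u != 0) ->
  exists L', (forall x, x \in L' <-> x \in L /\ dot a x = 0) /\ (\dim L').+1 = \dim L.
Proof.
move=> [u uL au].
have fl : linear (dot a : E -> R^o) by move=> c x y; rewrite dotDr dotZr.
pose F : {linear E -> R^o} := HB.pack (dot a : E -> R^o) (GRing.isLinear.Build _ _ _ _ (dot a : E -> R^o) fl).
pose g := linfun F.
have gE x : g x = dot a x by rewrite lfunE.
exists (L :&: lker g)%VS; split.
  move=> x; rewrite memv_cap memv_ker gE; split => [/andP[-> /eqP]//|[-> ->]].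
  by rewrite eqxx.
rewrite -(limg_ker_dim g L) -addn1; congr (_ + _)%N; apply/eqP.
rewrite eqn_leq; apply/andP; split.
  rewrite lt0n dimv_eq0; apply/eqP => h.
  have := memv_img g uL; rewrite h memv0 gE; exact/negP.
by apply: leq_trans (dimvS (subvf _)) _; rewrite dimvf.
Qed.

Lemma hyperplane_functional L' L : (L' <= L)%VS -> (\dim L').+1 = \dim L ->
  exists a u, [/\ u \in L, dot a u = 1 & forall x, x \in L' <-> x \in L /\ dot a x = 0].
Proof.
move=> sL dL.
have [u uL uL'] : exists2 u, u \in L & u \notin L'.
  have /subvPn[u uL uL'] : ~~ (L <= L')%VS.
    by apply/negP => /dimvS; rewrite -dL ltnn.
  by exists u.
have [a [aL' au]] := separating_functional uL'.
have [|M [ME dM]] := @hyperplane_dim L a; first by exists u => //; rewrite au oner_neq0.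
exists a, u; split=> // x; rewrite -ME.
suff -> : L' = M by [].
have sM : (L' <= M)%VS by apply/subvP => y yL'; apply/ME; rewrite (subvP sL)// aL'.
by apply/eqP; rewrite -(dimv_leqif_eq sM); apply/eqP; apply: succn_inj; rewrite dL dM.
Qed.

Lemma translateP v L x : translate v L x <-> x - v \in L.
Proof.
split=> [[y yL <-]|xL]; first by rewrite addrC addKr.
by exists (x - v) => //; rewrite addrC subrK.
Qed.

Lemma translate_base v L : translate v L v.
Proof. by apply/translateP; rewrite subrr mem0v. Qed.

Lemma translateB v L x y : translate v L x -> translate v L y -> x - y \in L.
Proof.
move=> /translateP xL /translateP yL.
by have -> : x - y = (x - v) - (y - v); [vec|exact: memvB].
Qed.

Lemma translateD v L x u : translate v L x -> u \in L -> translate v L (x + u).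
Proof. by move=> /translateP xL uL; apply/translateP; rewrite addrAC memvD. Qed.

Lemma translate_rebase v L w : translate v L w -> translate v L = translate w L.
Proof.
move=> vw; apply/seteqP; split => x vx.
  by apply/translateP; exact: translateB vx vw.
by move/translateP: vx => /(translateD vw); rewrite addrC subrK.
Qed.

Lemma translate_inj v L v' L' : translate v L = translate v' L' -> L = L'.
Proof.
move=> e; have : translate v' L' v by rewrite -e; exact: translate_base.
move=> /translate_rebase e'; rewrite {}e' in e.
apply/vspaceP => x; have /seteqP[s1 s2] := e; apply/idP/idP => xL.
  by have /translateP := s1 (v + x) (translateD (translate_base _ _) xL); rewrite addrC addKr.
by have /translateP := s2 (v + x) (translateD (translate_base _ _) xL); rewrite addrC addKr.
Qed.

Lemma translate_conv v L x y t : translate v L x -> translate v L y ->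
  translate v L (t *: x + (1 - t) *: y).
Proof.
move=> vx vy; have -> : t *: x + (1 - t) *: y = y + t *: (x - y) by vec.
by apply: translateD => //; rewrite memvZ// (translateB vx vy).
Qed.

Lemma sub_affine_hull B : B `<=` affine_hull B.
Proof.
move=> x Bx; exists 1%N, (fun=> 1), (fun=> x); split => //.
  by rewrite big_ord1.
by rewrite big_ord1 scale1r.
Qed.

Lemma affine_hull_min B v L : B `<=` translate v L -> affine_hull B `<=` translate v L.
Proof.
move=> BL x [k [c [p [pB c1 ->]]]]; apply/translateP.
rewrite -[v]scale1r -c1 scaler_suml -sumrB; apply: memv_suml => i _.
by rewrite -scalerBr memvZ//; apply/translateP/BL.
Qed.

Lemma affine_hull_translate v L : affine_hull (translate v L) = translate v L.
Proof. by apply/seteqP; split; [exact: affine_hull_min|exact: sub_affine_hull]. Qed.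

Lemma affine_hull_span B b : B b -> exists X : seq E,
  (forall x, x \in X -> B (b + x)) /\ affine_hull B = translate b <<X>>.
Proof.
move=> Bb; have [X [XB BX]] := finite_generation [set x | B (b + x)].
exists X; split => //; apply/seteqP; split.
  apply: affine_hull_min => x Bx; apply/translateP; apply: BX => /=.
  by rewrite addrC subrK.
move=> x /translateP /span_coordP[c xE].
(* An extra coefficient on the base point [b] brings the sum of the coefficients to 1. *)
exists (size X).+1, (fun i => if unlift ord0 i is Some j then c j else 1 - \sum_j c j),
  (fun i => if unlift ord0 i is Some j then b + X`_j else b); split.
- move=> i; case: unliftP => [j _|_] //; exact/XB/mem_nth.
- rewrite big_ord_recl unlift_none.
  rewrite [X in _ + X](eq_bigr c) ?subrK// => i _; by case: unliftP => [j /lift_inj ->|/eqP]; rewrite // eq_sym (negPf (neq_lift _ _)).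
- rewrite big_ord_recl unlift_none.
  rewrite [X in _ + X](eq_bigr (fun i => c i *: b + c i *: X`_i)) => [|i _]; last first.
    by case: unliftP => [j /lift_inj ->|/eqP]; rewrite ?scalerDr// eq_sym (negPf (neq_lift _ _)).
  by rewrite big_split /= -scaler_suml -xE scalerBl scale1r addrA subrK addrC subrK.
Qed.

Lemma has_dim_translate v L : has_dim (translate v L) (\dim L).
Proof. by exists v, L; rewrite affine_hull_translate. Qed.

Lemma has_dim_uniq B d d' : has_dim B d -> has_dim B d' -> d = d'.
Proof. by move=> [v [L [e <-]]] [v' [L' [e' <-]]]; move: e; rewrite e' => /translate_inj ->. Qed.

Lemma has_dim_nonempty B d : has_dim B d -> B !=set0.
Proof.
move=> [v [L [e _]]]; have : affine_hull B v by rewrite e; exact: translate_base.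
move=> [[|k] [c [p [pB c1 _]]]]; last by exists (p ord0).
by move: c1; rewrite big_ord0 => /eqP; rewrite eq_sym oner_eq0.
Qed.

Lemma convexP B : convex_set B <->
  forall x y t, B x -> B y -> 0 <= t -> t <= 1 -> B (t *: x + (1 - t) *: y).
Proof.
split=> [cB x y t Bx By t0 t1|cB].
  have t01 : (0 <= t <= 1) by rewrite t0.
  have /(_ (@Itv01 R t t0 t1)) := cB x y _ (mem_set Bx) (mem_set By).
  by rewrite inE /=.
move=> x y t /set_mem Bx /set_mem By; apply/mem_set; apply: cB => //.
Qed.

Lemma translate_convex v L : convex_set (translate v L).
Proof. by apply/convexP => x y t vx vy _ _; exact: translate_conv. Qed.

Lemma convex_step B x y t : convex_set B -> B x -> B (x + y) -> 0 <= t <= 1 -> B (x + t *: y).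
Proof.
move=> /convexP cB Bx Bxy /andP[t0 t1]; have := cB _ _ t Bxy Bx t0 t1.
by congr B; vec.
Qed.

Lemma nbhs_subspace_ballP (U : set E) x (P : set E) : U x ->
  nbhs (x : subspace U) P <-> exists2 e : R, 0 < e & forall y, U y -> `|y - x| < e -> P y.
Proof.
move=> Ux; case: (nbhs_subspaceP U x) => // _; split.
  move=> /nbhs_ballP[e /= e0 h]; exists e => // y Uy yx; apply: h => //.
  by rewrite mx_norm_ball /ball_ /= distrC.
move=> [e e0 h]; apply/nbhs_ballP; exists e => //= y.
by rewrite mx_norm_ball /ball_ /= distrC => yx Uy; exact: h.
Qed.

Lemma interior_inP (U : set E) B x : U x ->
  (interior_in U B x <-> exists2 e : R, 0 < e & forall y, U y -> `|y - x| < e -> B y).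
Proof. exact: nbhs_subspace_ballP. Qed.

Lemma interior_in_sub U B : interior_in U B `<=` B.
Proof. exact: (@interior_subset (subspace U)). Qed.

End LinearAlgebra.

(** * Interiors and separation *)

Section Convexity.
Context {R : realType} {n : nat}.
Local Notation E := 'rV[R]_n.
Implicit Types (a u v w x y z : E) (L M A : {vspace E}) (c t : R) (B S : set E).

Lemma div_itv c t : 0 <= c -> c <= t -> 0 < t -> 0 <= c / t <= 1.
Proof. by move=> c0 ct t0; rewrite divr_ge0 ?(ltW t0)//= ler_pdivrMr// mul1r. Qed.

(** Induction on [X], averaging a step along the head with a point of the box of the tail. Averaging
    halves the coefficients, hence the doubled coefficients and the halved radius. *)
Lemma core_box x B (X : seq E) : convex_set B -> B x ->
  (forall u, u \in X -> exists2 d : R, 0 < d & B (x + d *: u)) ->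
  (forall u, u \in X -> exists2 d : R, 0 < d & B (x - d *: u)) ->
  exists2 d : R, 0 < d & forall c : nat -> R, (forall i, `|c i| < d) ->
    B (x + \sum_(i < size X) c i *: X`_i).
Proof.
move=> cB Bx; elim: X => [|u X IH] Xp Xn.
  by exists 1 => // c _; rewrite big_ord0 addr0.
have [||d1 d10 h1] := IH.
- by move=> v vX; apply: Xp; rewrite inE vX orbT.
- by move=> v vX; apply: Xn; rewrite inE vX orbT.
have [|d2 d20 h2] := Xp u; first by rewrite inE eqxx.
have [|d3 d30 h3] := Xn u; first by rewrite inE eqxx.
exists (Num.min d1 (Num.min d2 d3) / 2).
  by rewrite divr_gt0// !lt_min d10 d20 d30.
move=> c cd; rewrite big_ord_recl /=.
have cdd i : `|2 * c i| < Num.min d1 (Num.min d2 d3).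
  by rewrite normrM ger0_norm// mulrC -ltr_pdivlMr.
pose s : E := \sum_(i < size X) c (bump 0 i) *: X`_i.
have -> : x + (c 0%N *: u + s) =
  2^-1 *: (x + (2 * c 0%N) *: u) + (1 - 2^-1) *: (x + 2 *: s).
  by apply/rowP => j; rewrite ?mxE; field.
have half : 0 <= 2^-1 :> R /\ 2^-1 <= 1 :> R by split; lra.
case: half => half0 half1.
move/convexP: (cB) => cB'; apply: cB' => //.
  have := cdd 0%N; rewrite !lt_min => /and3P[_].
  set k := 2 * c 0%N => kd2 kd3; have [k0|k0] := leP 0 k.
    have -> : k *: u = (k / d2) *: (d2 *: u) by rewrite scalerA divfK// gt_eqF.
    apply: convex_step => //; apply: div_itv => //.
    by rewrite (le_trans (ler_norm _))// ltW.
  have -> : k *: u = (- k / d3) *: (- (d3 *: u)).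
    by rewrite scalerN scalerA divfK ?gt_eqF// scaleNr opprK.
  apply: convex_step => //; apply: div_itv => //; first by rewrite oppr_ge0 ltW.
  by rewrite -ltr0_norm// ltW.
have -> : 2 *: s = \sum_(i < size X) (2 * c i.+1) *: X`_i.
  by rewrite scaler_sumr; apply: eq_bigr => i _; rewrite scalerA.
apply: (h1 (fun i => 2 * c i.+1)) => i.
by have := cdd i.+1; rewrite !lt_min => /and3P[].
Qed.

(** In finite dimension the algebraic interior of a convex set is its topological interior:
    [core_box] on a basis of [L] gives a box, and coordinates are bounded by the norm. *)
Lemma core_interior z L B x : B `<=` translate z L -> convex_set B -> B x ->
  (forall u, u \in L -> exists2 d : R, 0 < d & B (x + d *: u)) ->
  interior_in (translate z L) B x.
Proof.
move=> BL cB Bx core; apply/interior_inP; first exact: BL.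
have XL u : u \in (vbasis L : seq E) -> u \in L by exact: vbasis_mem.
have [||d d0 h] := @core_box x B (vbasis L) cB Bx.
- by move=> u /XL; exact: core.
- by move=> u /XL uL; have [|d d0] := core (- u); [rewrite memvN|rewrite scalerN; exists d].
have coordK i : exists2 K : R, 0 <= K & forall y, `|coord (vbasis L) i y| <= K * `|y|.
  have [a aE] := functional_dot (coord (vbasis L) i).
  exists (\sum_i `|a 0 i|); first exact: sumr_ge0.
  by move=> y; rewrite aE; exact: dot_le_norm.
pose K i := sval (cid2 (coordK i)).
have K0 i : 0 <= K i by rewrite /K; case: cid2.
have KE i y : `|coord (vbasis L) i y| <= K i * `|y| by rewrite /K; case: cid2.
have sK0 : 0 < 1 + \sum_i K i by rewrite ltr_pwDl// sumr_ge0.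
exists (d / (1 + \sum_i K i)); first exact: divr_gt0.
move=> y yL yx.
have yxL : y - x \in L by exact: translateB yL (BL _ Bx).
(* [core_box] takes coefficients indexed by [nat], so the coordinates are padded with 0. *)
pose c (i : nat) : R := if insub i is Some j then coord (vbasis L) j (y - x) else 0.
have cd i : `|c i| < d.
  rewrite /c; case: insubP => [j _ _|_]; last by rewrite normr0.
  apply: le_lt_trans (KE _ _) _; move: yx; rewrite ltr_pdivlMr// => /(le_lt_trans _); apply.
  rewrite mulrC ler_wpM2l// (bigD1 j)//= addrCA lerDl.
  by rewrite ltW// ltr_pwDl// sumr_ge0.
have := h c cd; congr B; rewrite size_tuple.
rewrite -[RHS](subrK x) addrC; congr (_ + _).
rewrite [RHS](coord_vbasis yxL); apply: eq_bigr => i _.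
by rewrite /c valK.
Qed.

Lemma interior_near z L B x : interior_in (translate z L) B x ->
  translate z L x ->
  exists2 e : R, 0 < e & forall y, translate z L y -> `|y - x| < e ->
    interior_in (translate z L) B y.
Proof.
move=> Ix Lx; have [e e0 h] := (interior_inP B Lx).1 Ix.
exists (e / 2) => [|y Ly yx]; first exact: divr_gt0.
apply/interior_inP => //; exists (e / 2) => [|w Lw wy]; first exact: divr_gt0.
apply: h => //; rewrite -(subrK y w) -addrA (le_lt_trans (ler_normD _ _))//.
by rewrite [ltRHS]splitr ltrD.
Qed.

Lemma interior_push z L B x u : B `<=` translate z L ->
  interior_in (translate z L) B x -> u \in L ->
  exists2 d : R, 0 < d & forall t, `|t| <= d -> interior_in (translate z L) B (x + t *: u).
Proof.
move=> BL Ix uL; have Lx : translate z L x by exact: BL (interior_in_sub Ix).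
have [e e0 h] := interior_near Ix Lx.
have u0 : 0 < `|u| + 1 by rewrite ltr_pwDr.
exists (e / 2 / (`|u| + 1)); first by rewrite !divr_gt0.
move=> t td; apply: h; first by apply: translateD => //; rewrite memvZ.
have -> : x + t *: u - x = t *: u by vec.
rewrite normrZ; apply: (@le_lt_trans _ _ (e / 2 / (`|u| + 1) * `|u|)).
  exact: ler_wpM2r.
apply: (@le_lt_trans _ _ (e / 2)); last by lra.
rewrite -mulrA -[leRHS]mulr1 ler_pM2l ?divr_gt0//.
by rewrite mulrC ler_pdivrMr// mul1r lerDl.
Qed.

(** The homothety of centre [y] and ratio [1 - t] carries a ball around [x] to a ball around the new
    point, and convexity keeps it in [B]. *)
Lemma interior_convex_step z L B x y t : B `<=` translate z L -> convex_set B ->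
  interior_in (translate z L) B x -> B y -> 0 <= t < 1 ->
  interior_in (translate z L) B (x + t *: (y - x)).
Proof.
move=> BL cB Ix By /andP[t0 t1].
have Lx : translate z L x by exact: BL (interior_in_sub Ix).
have yxL : y - x \in L by exact: translateB (BL _ By) Lx.
have [e e0 h] := (interior_inP B Lx).1 Ix.
set p := x + _; have Lp : translate z L p by apply: translateD => //; rewrite memvZ.
have t1' : 0 < 1 - t by rewrite subr_gt0.
apply/interior_inP => //; exists (e * (1 - t)) => [|w Lw wp]; first exact: mulr_gt0.
have -> : w = t *: y + (1 - t) *: (x + (1 - t)^-1 *: (w - p)).
  rewrite scalerDr scalerA divff ?gt_eqF// scale1r /p; vec.
move/convexP: cB; apply => //; last exact: ltW.
apply: h; first by apply: translateD => //; rewrite memvZ// (translateB Lw).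
have -> : x + (1 - t)^-1 *: (w - p) - x = (1 - t)^-1 *: (w - p) by vec.
by rewrite normrZ gtr0_norm ?invr_gt0// mulrC ltr_pdivrMr.
Qed.

Lemma convex_comb B k (c : 'I_k -> R) (p : 'I_k -> E) : convex_set B ->
  (forall i, B (p i)) -> (forall i, 0 <= c i) -> \sum_i c i = 1 ->
  B (\sum_i c i *: p i).
Proof.
move=> cB; elim: k c p => [|k IH] c p pB c0 c1.
  by move: c1; rewrite big_ord0 => /eqP; rewrite eq_sym oner_eq0.
rewrite big_ord_recl; move: (c1); rewrite big_ord_recl => c1'.
have s0 : 0 <= \sum_(i < k) c (lift ord0 i) by exact: sumr_ge0.
have [c01|c01] := eqVneq (c ord0) 1.
  have /psumr_eq0P cz : \sum_(i < k) c (lift ord0 i) = 0.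
    by apply: (addrI (c ord0)); rewrite c1' addr0 c01.
  rewrite big1 ?addr0 ?c01 ?scale1r// => i _; rewrite cz ?scale0r//.
have cn : 1 - c ord0 != 0 by rewrite subr_eq0 eq_sym.
have -> : \sum_(i < k) c (lift ord0 i) *: p (lift ord0 i) =
  (1 - c ord0) *: \sum_(i < k) (c (lift ord0 i) / (1 - c ord0)) *: p (lift ord0 i).
  by rewrite scaler_sumr; apply: eq_bigr => i _; rewrite scalerA mulrC divfK.
have c01' : 0 <= 1 - c ord0 by rewrite -c1' addrC addKr.
move/convexP: (cB); apply => //; last by rewrite -subr_ge0.
apply: IH => // [i|]; first exact: divr_ge0.
by rewrite -mulr_suml -[X in X / _](addKr (c ord0)) c1' addrC divff.
Qed.

(** [B] contains a simplex with vertex [b] whose edges at [b] span [L]; its barycentre is the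
    interior point. *)
Lemma full_dim_interior z L B : convex_set B -> affine_hull B = translate z L ->
  exists x, interior_in (translate z L) B x.
Proof.
move=> cB hB.
have BL : B `<=` translate z L by rewrite -hB; exact: sub_affine_hull.
have [b Bb] : B !=set0 by apply: (@has_dim_nonempty _ _ _ (\dim L)); exists z, L.
have [X [XB hX]] := affine_hull_span Bb.
have LX : L = <<X>>%VS by apply: (@translate_inj _ _ z _ b); rewrite -hB.
have comb (d : 'I_(size X) -> R) : (forall i, 0 <= d i) -> \sum_i d i <= 1 ->
    B (b + \sum_i d i *: X`_i).
  move=> d0 d1.
  pose c (i : 'I_(size X).+1) := if unlift ord0 i is Some j then d j else 1 - \sum_j d j.
  pose p (i : 'I_(size X).+1) := if unlift ord0 i is Some j then b + X`_j else b.
  have cE i : c (lift ord0 i) = d i.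
    by rewrite /c; case: unliftP => [j /lift_inj ->//|/eqP]; rewrite eq_sym (negPf (neq_lift _ _)).
  have pE i : p (lift ord0 i) = b + X`_i.
    by rewrite /p; case: unliftP => [j /lift_inj ->//|/eqP]; rewrite eq_sym (negPf (neq_lift _ _)).
  have c00 : c ord0 = 1 - \sum_j d j by rewrite /c unlift_none.
  have p00 : p ord0 = b by rewrite /p unlift_none.
  have := @convex_comb B _ c p cB.
  rewrite !big_ord_recl c00 p00.
  have -> : \sum_(i < size X) c (lift ord0 i) = \sum_i d i by apply: eq_bigr => i _; rewrite cE.
  have -> : \sum_(i < size X) c (lift ord0 i) *: p (lift ord0 i) =
      \sum_i (d i *: b + d i *: X`_i).
    by apply: eq_bigr => i _; rewrite cE pE scalerDr.
  rewrite big_split /= -scaler_suml subrK addrA -scalerDl subrK scale1r; apply => //.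
    by move=> i; rewrite /p; case: unliftP => // j _; exact/XB/mem_nth.
  by move=> i; rewrite /c; case: unliftP => // _; rewrite subr_ge0.
(* The number of vertices: every barycentric coordinate of the barycentre is [m^-1]. *)
pose m : R := (size X).+1%:R.
have m0 : 0 < m by rewrite ltr0n.
have sm (r : R) : \sum_(i < size X) r = (m - 1) * r.
  by rewrite sumr_const card_ord /m -natr1 addrK mulr_natl.
exists (b + \sum_(i < size X) m^-1 *: X`_i); apply: core_interior => //.
  apply: comb => [i|]; first by rewrite invr_ge0 ltW.
  by rewrite sm mulrBl mul1r divff ?gt_eqF// lerBlDr lerDl invr_ge0 ltW.
move=> u; rewrite LX => /span_coordP[d ->].
pose D := 1 + \sum_i `|d i|.
have D0 : 0 < D by rewrite ltr_pwDl// sumr_ge0.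
have dD i : `|d i| <= D.
  by rewrite /D (bigD1 i)//= addrCA lerDl ltW// ltr_pwDl// sumr_ge0.
have sD : \sum_i d i <= D.
  by rewrite /D ler_wpDl// ler_sum// => i _; exact: ler_norm.
have mD : 0 < m^-1 / D by rewrite divr_gt0 ?invr_gt0.
(* With this step no barycentric coordinate, that of [b] included, decreases by more than [m^-1]. *)
exists (m^-1 / D) => //.
rewrite -addrA scaler_sumr -big_split /=.
rewrite (eq_bigr (fun i => (m^-1 + m^-1 / D * d i) *: X`_i)) => [|i _]; last first.
  by rewrite scalerDl scalerA.
apply: comb => [i|].
  have -> : m^-1 + m^-1 / D * d i = m^-1 / D * (D + d i).
    by field; rewrite !gt_eqF.
  apply: mulr_ge0; first exact: ltW.
  have := dD i; rewrite ler_norml => /andP[h _]; lra.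
rewrite big_split /= sm -mulr_sumr.
have -> : (m - 1) * m^-1 + m^-1 / D * \sum_i d i = 1 - m^-1 / D * (D - \sum_i d i).
  by field; rewrite !gt_eqF.
by rewrite lerBlDr lerDl mulr_ge0 ?subr_ge0// ltW.
Qed.

(* Geometric Hahn-Banach for the open cone [K]: while [A] is not a hyperplane,
   it can be enlarged by a vector [u + s *: k0], the value [s] being the infimum of
   those for which [u + s *: k0] lies in [K + A]. *)
Lemma open_cone_separation M A (K : set E) : (A <= M)%VS ->
  (forall x, K x -> x \in M) -> (forall x y, K x -> K y -> K (x + y)) ->
  (forall t x, 0 < t -> K x -> K (t *: x)) ->
  (forall x u, K x -> u \in M -> exists2 d : R, 0 < d & K (x + d *: u)) ->
  (forall x, x \in A -> ~ K x) -> K !=set0 ->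
  exists a, (forall x, x \in A -> dot a x = 0) /\ (forall x, K x -> 0 < dot a x).
Proof.
move=> AW KW KD KZ Ko AK [k0 Kk0].
have [m] := ubnP (\dim M - \dim A).
elim: m A AW AK => // m IH A AW AK; rewrite ltnS => dm.
have k0A : k0 \notin A by apply/negP => /AK; exact.
have k0W := KW _ Kk0.
(* If [A] and [k0] span [M], the functional that vanishes on [A] and is 1 at [k0] works: from a
   point of [K] with nonpositive value, adding a multiple of [k0] would reach [A] inside [K]. *)
have [Wk|/subvPn[u uW uAk]] := boolP (M <= A + <[k0]>)%VS.
  have [a [aA ak]] := separating_functional k0A; exists a; split => // x Kx.
  have /memv_addP[l lA [_ /vlineP[c ->] xE]] := subvP Wk _ (KW _ Kx).
  rewrite xE dotDr dotZr aA// ak add0r mulr1 ltNge; apply/negP => c0.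
  apply: (AK l lA); have -> : l = x + (- c) *: k0 by rewrite xE; vec.
  move: c0; rewrite le_eqVlt => /predU1P[->|c0]; first by rewrite oppr0 scale0r addr0.
  by apply: KD => //; apply: KZ => //; rewrite oppr_gt0.
(* [P] and [Q] record where the line [u + s *: k0] meets [K + A] and its opposite. Both are
   nonempty, [Q] lies strictly below [P], and openness of [K] denies a least element to [P] and a
   greatest one to [Q]; so [inf P] is in neither. *)
pose P : set R := [set s | exists2 l, l \in A & K (u + s *: k0 + l)].
pose Q : set R := [set s | exists2 l, l \in A & K (- (u + s *: k0) + l)].
have [p Pp] : P !=set0.
  have [d d0 Kd] := Ko _ _ Kk0 uW; exists d^-1, 0; first exact: mem0v.
  have -> : u + d^-1 *: k0 + 0 = d^-1 *: (k0 + d *: u).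
    by rewrite scalerDr scalerA mulVf ?gt_eqF// scale1r addr0 addrC.
  by apply: KZ => //; rewrite invr_gt0.
have [q Qq] : Q !=set0.
  have [|d d0 Kd] := Ko _ (- u) Kk0; first by rewrite memvN.
  exists (- d^-1), 0; first exact: mem0v.
  have -> : - (u + - d^-1 *: k0) + 0 = d^-1 *: (k0 + d *: (- u)).
    rewrite scalerDr scalerA mulVf ?gt_eqF// scale1r; vec.
  by apply: KZ => //; rewrite invr_gt0.
have QP r s : Q r -> P s -> r < s.
  move=> [l lA Kl] [l' lA' Kl']; rewrite ltNge; apply/negP => sr.
  have Kll := KD _ _ Kl Kl'.
  have lA2 : l + l' \in A by rewrite memvD.
  apply: (AK _ lA2).
  have -> : l + l' = (- (u + r *: k0) + l) + (u + s *: k0 + l') + (r - s) *: k0 by vec.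
  move: sr; rewrite le_eqVlt -subr_eq0 => /orP[/eqP sr|sr].
    by rewrite -(opprB s) sr oppr0 scale0r addr0.
  by apply: KD => //; apply: KZ => //; rewrite subr_gt0.
have infP : has_inf P by split; [exists p | exists q => r /(QP q r Qq)/ltW].
pose s := inf P.
have nP : ~ P s.
  move=> [l lA Kl]; have [|d d0 Kd] := Ko _ (- k0) Kl; first by rewrite memvN.
  have : s <= s - d.
    apply: ge_inf; first by case: infP.
    exists l => //; move: Kd; congr K; vec.
  by rewrite leNgt gtrBl d0.
have nQ : ~ Q s.
  move=> [l lA Kl]; have [|d d0 Kd] := Ko _ (- k0) Kl; first by rewrite memvN.
  have Qs : Q (s + d) by exists l => //; move: Kd; congr K; vec.
  have : s + d <= s.
    by apply: lb_le_inf; [exists p|move=> r /(QP _ _ Qs)/ltW].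
  by rewrite leNgt ltrDl d0.
pose v := u + s *: k0.
have vA : v \notin A.
  apply: contra uAk => vA; have -> : u = v + (- s) *: k0 by rewrite /v; vec.
  by rewrite memv_add// memvZ// memv_line.
have vW : v \in M by rewrite memvD// memvZ.
have sA : (A <= A + <[v]>)%VS by exact: addvSl.
have AvW : (A + <[v]> <= M)%VS by rewrite subv_add AW -memvE.
have dlt : (\dim A < \dim (A + <[v]>))%N.
  rewrite (ltn_leqif (dimv_leqif_sup sA)); apply: contra vA => /subvP; apply.
  by rewrite (subvP (addvSr _ _))// memv_line.
have [||a [aA aK]] := IH (A + <[v]>)%VS AvW.
(* A vector [l + t *: v] of [K], divided by the absolute value of [t], would put [s] in [Q] or [P]
   according to the sign of [t]; for [t = 0] it would lie in [A]. *)
- move=> _ /memv_addP[l lA [_ /vlineP[t ->] ->]] Kx.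
  have [t0|t0|t0] := ltgtP t 0.
  + apply: nQ; exists ((- t)^-1 *: l); first exact: memvZ.
    have := KZ (- t)^-1 _ _ Kx; rewrite invr_gt0 oppr_gt0 => /(_ t0).
    congr K; rewrite scalerDr scalerA invrN mulNr mulVf ?lt_eqF// scaleN1r addrC.
    by rewrite -/v.
  + apply: nP; exists (t^-1 *: l); first exact: memvZ.
    have := KZ t^-1 _ _ Kx; rewrite invr_gt0 => /(_ t0).
    by congr K; rewrite scalerDr scalerA mulVf ?gt_eqF// scale1r addrC.
  + by apply: (AK _ lA); move: Kx; rewrite t0 scale0r addr0.
- by apply: leq_trans dm; rewrite ltn_sub2l// (leq_trans dlt)// dimvS.
- by exists a; split=> // x xA; apply: aA; exact: (subvP sA).
Qed.

(** The cone generated by the vectors [z - s], for [s] interior to [S], is open and misses [A], so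
    [open_cone_separation] applies. The weak inequality passes from the interior to [S] along
    segments issued from [x0]. *)
Lemma affine_separation z M A S x0 : S `<=` translate z M -> convex_set S ->
  interior_in (translate z M) S x0 -> (A <= M)%VS ->
  (forall x, x \in A -> ~ interior_in (translate z M) S (z + x)) ->
  exists a, [/\ forall x, x \in A -> dot a x = 0,
    forall s, S s -> dot a s <= dot a z &
    forall s, interior_in (translate z M) S s -> dot a s < dot a z].
Proof.
move=> SW cS I0 AW AS; set I := interior_in (translate z M) S in I0 AS *.
have IS s : I s -> S s by exact: interior_in_sub.
pose K : set E := [set k | exists t s, [/\ 0 < t, I s & k = t *: (z - s)]].
have [||||| |a [aA aK]] := @open_cone_separation M A K AW.
- move=> _ [t [s [_ /IS/SW sW ->]]].
  by rewrite memvZ// (translateB (translate_base _ _) sW).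
- move=> _ _ [t [s [t0 Is ->]]] [r [y [r0 Iy ->]]].
  have tr0 : 0 < t + r by rewrite addr_gt0.
  exists (t + r), (s + (r / (t + r)) *: (y - s)); split => //.
    apply: interior_convex_step => //; first exact: IS.
    by rewrite divr_ge0 ?ltW//= ltr_pdivrMr// mul1r ltrDr.
  by apply/rowP => i; rewrite !mxE; field; rewrite gt_eqF.
- move=> t _ t0 [r [y [r0 Iy ->]]]; exists (t * r), y; split => //; first exact: mulr_gt0.
  by rewrite scalerA.
- move=> _ u [r [y [r0 Iy ->]]] uW.
  have [d d0 hd] := interior_push SW Iy uW.
  exists (r * d); first exact: mulr_gt0.
  exists r, (y + (- d) *: u); split => //; last by vec.
  by apply: hd; rewrite normrN gtr0_norm.
- move=> x xA [t [s [t0 Is xE]]]; apply: (AS (- (t^-1 *: x))).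
    by rewrite memvN memvZ.
  move: Is; congr I; rewrite xE scalerA mulVf ?gt_eqF// scale1r; vec.
- by exists (1 *: (z - x0)), 1, x0.
have aI s : I s -> dot a s < dot a z.
  move=> Is; rewrite -subr_gt0 -dotBr; apply: aK.
  by exists 1, s; split => //; rewrite scale1r.
exists a; split => // s Ss; rewrite leNgt; apply/negP => as0.
have a0 := aI _ I0.
(* The parameter at which the segment from [x0] to [s] reaches the level of [z], at a point that is
   still interior. *)
pose t := (dot a z - dot a x0) / (dot a s - dot a x0).
have d0 : 0 < dot a s - dot a x0 by lra.
have t01 : 0 <= t < 1.
  rewrite /t divr_ge0 ?ltW//= ?subr_gt0//= ltr_pdivrMr// mul1r; lra.
have := aI _ (interior_convex_step SW cS I0 Ss t01).
by rewrite !dotE /t divfK ?gt_eqF// addrC subrK ltxx.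
Qed.

(** From an interior point both directions [u] and [- u] are available, and one of them increases
    [dot a]. *)
Lemma interior_lt z L B a c x : B `<=` translate z L ->
  (forall y, B y -> dot a y <= c) -> (exists2 u, u \in L & dot a u != 0) ->
  interior_in (translate z L) B x -> dot a x < c.
Proof.
move=> BL Bc [u uL au] Ix; have [d d0 h] := interior_push BL Ix uL.
have h1 : dot a (x + d *: u) <= c by apply: Bc (interior_in_sub (h _ _)); rewrite gtr0_norm.
have h2 : dot a (x + (- d) *: u) <= c by apply: Bc (interior_in_sub (h _ _)); rewrite normrN gtr0_norm.
move: h1 h2; rewrite !dotE => h1 h2.
have : d * dot a u != 0 by rewrite mulf_neq0// gt_eqF.
by rewrite neq_lt => /orP[k0|k0]; lra.
Qed.

End Convexity.

(** * Lattices and the polyhedrality of maximal lattice-free sets *)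

Section Lattice.
Context {R : realType} {n : nat}.
Local Notation E := 'rV[R]_n.
Implicit Types (a u v w x y z r : E) (L V : {vspace E}) (c t e : R) (B S : set E).

(** Bolzano-Weierstrass; the bound [K] gives arbitrarily late indices, which replaces the extraction
    of a subsequence. *)
Lemma cluster_point (x : nat -> E) c : (forall k, `|x k| <= c) ->
  exists p, forall e K, 0 < e -> exists k, (K <= k)%N /\ `|x k - p| < e.
Proof.
move=> xc; pose D : set E := [set v | `|v| <= c].
have cD : compact D.
  apply: bounded_closed_compact.
    by exists c; split; [exact: num_real|move=> M cM v /= vc; exact: le_trans vc (ltW cM)].
  apply: (@closed_comp _ _ (Num.norm : E -> R) [set t | t <= c]); last exact: closed_le.
  by move=> v _; exact: norm_continuous.
have [|p [_ pc]] := cD (x @ \oo) _; first by exists 0%N => // k _; exact: xc.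
exists p => e K e0.
have [|_ [[k Kk <-] /= kp]] := pc [set x k | k in [set k | (K <= k)%N]] (ball p e) _ (nbhsx_ballx _ _ e0).
  by exists K => // k /= Kk; exists k.
by exists k; split => //; move: kp; rewrite mx_norm_ball /ball_ /= distrC.
Qed.

Lemma infinite_close B c e : infinite_set B -> (forall x, B x -> `|x| <= c) -> 0 < e ->
  exists x y, [/\ B x, B y, x != y & `|x - y| < e].
Proof.
move=> /infiniteP/pcard_leP/injfunPex[f fB finj] Bc e0.
have [k|p hp] := @cluster_point f c; first exact/Bc/fB.
have e2 : 0 < e / 2 by exact: divr_gt0.
have [i [_ ip]] := hp _ 0%N e2; have [j [ij jp]] := hp _ i.+1 e2.
exists (f i), (f j); split; [exact: fB|exact: fB| |].
  apply/eqP => /finj; rewrite !inE => /(_ Logic.I Logic.I) ji; move: ij; rewrite ji ltnn//.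
have -> : f i - f j = (f i - p) - (f j - p) by vec.
by rewrite (le_lt_trans (ler_normB _ _))// [ltRHS]splitr ltrD.
Qed.

Lemma integralD x y : integral_points x -> integral_points y -> integral_points (x + y).
Proof. by move=> ix iy i; rewrite mxE rpredD. Qed.

Lemma integralZ (m : int) x : integral_points x -> integral_points (m%:~R *: x).
Proof. by move=> ix i; rewrite mxE rpredM// intr_int. Qed.

Lemma integralB x y : integral_points x -> integral_points y -> integral_points (x - y).
Proof. by move=> ix iy i; rewrite !mxE rpredB. Qed.

Lemma integral0 : integral_points (0 : E).
Proof. by move=> i; rewrite mxE rpred0. Qed.

Lemma integral_sum (I : Type) (s : seq I) (F : I -> E) :
  (forall i, integral_points (F i)) -> integral_points (\sum_(i <- s) F i).
Proof.
by move=> iF; elim/big_ind: _ => // [|x y]; [exact: integral0|exact: integralD].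
Qed.

Lemma integral_small x : integral_points x -> `|x| < 1 -> x = 0.
Proof.
move=> ix x1; apply/rowP => i; rewrite mxE; apply/eqP; apply: contraTT x1 => xi.
by rewrite -leNgt (le_trans _ (coord_le_norm x i))// norm_intr_ge1.
Qed.

(** Distinct integral points are at distance at least 1, while by [infinite_close] an infinite
    bounded set has two distinct points closer than that. *)
Lemma integral_bounded c : exists s : seq E, forall x,
  integral_points x -> `|x| <= c -> x \in s.
Proof.
have /finite_seqP[s sE] : finite_set [set x : E | integral_points x /\ `|x| <= c].
  apply: contrapT => /(@infinite_close _ c 1)[x []//||x [y [[ix _] [iy _]]]] //.
  by rewrite -subr_eq0 => /eqP xy /(integral_small (integralB ix iy)).
exists s => x ix xc; have : [set x : E | integral_points x /\ `|x| <= c] x by [].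
by rewrite sE.
Qed.

Lemma limit_kernel (f : 'End(E)) u :
  (forall e, 0 < e -> exists2 r, f r = 0 & `|r - u| < e) -> f u = 0.
Proof.
move=> h; have [K K0 fK] := linear_bounded f.
apply/eqP; rewrite -normr_eq0 eq_le normr_ge0 andbT leNgt; apply/negP => fu.
have [r fr ru] := h (`|f u| / K) (divr_gt0 fu K0).
have := fK (r - u); rewrite linearB /= fr sub0r normrN => /le_lt_trans.
by move=> /(_ `|f u|); rewrite -ltr_pdivlMl// mulrC ru ltxx => /(_ isT).
Qed.

(** These are the rational subspaces. *)
Definition spanned_by_integral V :=
  exists2 X : seq E, (forall x, x \in X -> integral_points x) & V = <<X>>%VS.

Lemma floor_dist c : `|(Num.floor c)%:~R - c| <= 1.
Proof.
have := floor_le c; have := floorD1_gt c; rewrite intrD ler_norml => h1 h2.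
by apply/andP; split; lra.
Qed.
End Lattice.

(* Dirichlet: two of the points whose coordinates are the fractional parts of
   [k * c_i] are close to each other. *)
Lemma dirichlet {R : realType} {n : nat} (V : {vspace 'rV[R]_n}) r (e c : R) :
  spanned_by_integral V -> r \in V -> 0 < e ->
  exists t w, [/\ c <= t, integral_points w, w \in V & `|w - t *: r| < e].
Proof.
move=> [X iX ->] /span_coordP[b rE] e0.
pose x (k : nat) : 'rV[R]_(size X) :=
  \row_i (k%:R * b i - (Num.floor (k%:R * b i))%:~R).
have [k|p hp] := @cluster_point _ _ x 2.
  apply/ltW/norm_ltP => // i; rewrite mxE distrC (le_lt_trans (floor_dist _))//; lra.
pose D := 1 + \sum_(i < size X) `|X`_i|.
have D0 : 0 < D by rewrite ltr_pwDl// sumr_ge0.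
have e2 : 0 < e / D / 2 by rewrite !divr_gt0.
have [i [_ ip]] := hp _ 0%N e2.
(* The shift of the index makes [j - i] at least [c]. *)
have [j [ij jp]] := hp _ (i + (Num.truncn c).+1)%N e2.
have xij : `|x i - x j| < e / D.
  have -> : x i - x j = (x i - p) - (x j - p) by vec.
  by rewrite (le_lt_trans (ler_normB _ _))// [ltRHS]splitr ltrD.
(* Rounding the coordinates of [j *: r] and of [i *: r] down separately leaves as error the
   difference of the fractional parts, which is [x i - x j]. *)
pose w := \sum_(l < size X)
  ((Num.floor (j%:R * b l) - Num.floor (i%:R * b l))%:~R : R) *: X`_l.
have Xint (l : 'I_(size X)) : integral_points X`_l by apply/iX/mem_nth.
exists (j%:R - i%:R), w; split.
- rewrite lerBrDl; apply: (@le_trans _ _ (i + (Num.truncn c).+1)%:R); last by rewrite ler_nat.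
  by rewrite natrD lerD2l ltW// truncnS_gt.
- by apply: integral_sum => l; exact: integralZ.
- exact: span_comb.
have -> : w - (j%:R - i%:R) *: r = \sum_(l < size X) (x i - x j) 0 l *: X`_l.
  rewrite rE scaler_sumr -sumrB; apply: eq_bigr => l _.
  rewrite scalerA -scalerBl !mxE intrB; congr (_ *: _); ring.
apply: (le_lt_trans (ler_norm_sum _ _ _)).
apply: (@le_lt_trans _ _ (`|x i - x j| * D)); last by rewrite -ltr_pdivlMr.
rewrite /D mulrDr mulr1 mulr_sumr ler_wpDl// ler_sum// => l _.
by rewrite normrZ ler_wpM2r// coord_le_norm.
Qed.

(** * Finite description of a maximal lattice-free set with nonempty interior *)

Section MaximalPolyhedral.
Context {R : realType} {n : nat}.
Local Notation E := 'rV[R]_n.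
Implicit Types (u v w x y z r : E) (L : {vspace E}) (c t e : R) (B S : set E).
Variables (z0 : E) (V : {vspace E}) (C : set E) (x0 : E).
Local Notation U := (translate z0 V).
Hypotheses (sV : spanned_by_integral V).
Hypotheses (Cmax : maximal_lattice_free_convex U C) (Ix0 : interior_in U C x0).

Let CU : C `<=` U. Proof. by case: Cmax => -[]. Qed.
Let cC : convex_set C. Proof. by case: Cmax => -[]. Qed.
Let Cfree y : integral_points y -> ~ interior_in U C y.
Proof.
case: Cmax => -[_ _ h] _ iy Iy; have : (interior_in U C `&` integral_points) y by [].
by rewrite h.
Qed.
Let Cx0 : C x0. Proof. exact: interior_in_sub Ix0. Qed.

Lemma max_lattice_freeE B : B `<=` U -> convex_set B -> C `<=` B ->
  (forall y, integral_points y -> ~ interior_in U B y) -> B = C.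
Proof.
case: Cmax => _ max BU cB CB fB; apply: max => //; split => //.
by rewrite -subset0 => y [/fB]; apply.
Qed.

Lemma interior_translate x r : r \in V -> (forall y, C y -> C (y + r)) ->
  interior_in U C x -> interior_in U C (x + r).
Proof.
move=> rV rC Ix; have Ux : U x by exact: CU (interior_in_sub Ix).
have [e e0 h] := (interior_inP C Ux).1 Ix.
apply/interior_inP; first exact: translateD.
exists e => // y Uy yx; have -> : y = (y - r) + r by vec.
apply/rC/h; first by apply: translateD; rewrite ?memvN.
by have -> : y - r - x = y - (x + r) by vec.
Qed.

(* If the line [R u] lies in the closure of the sum of the lattice and of recession
   directions of [C], then [C + R u] is again lattice-free. *)
Lemma recession_line u : u \in V ->
  (forall t e, 0 < e -> exists w r, [/\ integral_points w, w \in V, r \in V,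
    (forall x, C x -> C (x + r)) & `|w - (t *: u + r)| < e]) ->
  forall x t, C x -> C (x + t *: u).
Proof.
move=> uV app.
pose B : set E := [set y | exists x t, C x /\ y = x + t *: u].
have CB : C `<=` B by move=> x Cx; exists x, 0; rewrite scale0r addr0.
have BU : B `<=` U by move=> _ [x [t [Cx ->]]]; apply: translateD; [exact: CU|rewrite memvZ].
suff BC : B = C by move=> x t Cx; rewrite -BC; exists x, t.
apply: max_lattice_freeE => //.
  apply/convexP => _ _ t [x [s [Cx ->]]] [x' [s' [Cx' ->]]] t0 t1.
  exists (t *: x + (1 - t) *: x'), (t * s + (1 - t) * s'); split; last by vec.
  by move/convexP: cC; apply.
move=> y iy IBy; have Uy : U y by exact: BU (interior_in_sub IBy).
have yxV : y - x0 \in V by exact: translateB Uy (CU Cx0).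
(* The segment from [x0] to [y] can be prolonged beyond [y] inside [B]. Contracting back towards
   [x0] writes [y] as an interior point [q] of [C] plus a multiple of [u]. *)
have [d d0 hd] := interior_push BU IBy yxV.
have [|c [s [Cc yE]]] := interior_in_sub (hd d _); first by rewrite gtr0_norm.
have d1 : 0 < 1 + d by rewrite addr_gt0.
pose q := x0 + (1 + d)^-1 *: (c - x0).
have Iq : interior_in U C q.
  apply: interior_convex_step => //; rewrite invr_ge0 ltW//= invf_lt1// ltrDl//.
have yq : y = q + (s / (1 + d)) *: u.
  have -> : y = (1 + d)^-1 *: ((y + d *: (y - x0)) + d *: x0).
    by apply/rowP => i; rewrite !mxE; field; rewrite gt_eqF.
  by rewrite yE /q; apply/rowP => i; rewrite !mxE; field; rewrite gt_eqF.
have [e e0 he] := interior_near Iq (CU (interior_in_sub Iq)).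
(* For the opposite multiple of [u], the point [y + w - r] is close to [q], so that the integral
   point [y + w] is interior to [C]. *)
have [w [r [iw wV rV rC wr]]] := app (- (s / (1 + d))) e e0.
apply: (Cfree (integralD iy iw)); have -> : y + w = (y + w - r) + r by vec.
apply: interior_translate => //; apply: he.
  by apply: translateD; rewrite ?memvN//; exact: translateD.
by have -> : y + w - r - q = w - (- (s / (1 + d)) *: u + r) by rewrite yq; vec.
Qed.

(** By [dirichlet] a lattice vector lies near [m *: r] for some [m >= t], and [(m - t) *: r] is a
    recession direction; so [recession_line] applies. *)
Lemma recession_opp r : r \in V -> (forall x t, 0 <= t -> C x -> C (x + t *: r)) ->
  forall x t, C x -> C (x + t *: r).
Proof.
move=> rV rC; apply: recession_line => // t e e0.
have [m [w [tm iw wV wm]]] := dirichlet t sV rV e0.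
exists w, ((m - t) *: r); split => //; first by rewrite memvZ.
  by move=> x; apply: rC; rewrite subr_ge0.
by have -> : t *: r + (m - t) *: r = m *: r by vec.
Qed.

Variable a : E -> E.
Hypothesis aC : forall z, integral_points z -> U z -> forall x, C x -> dot (a z) x <= dot (a z) z.
Hypothesis ax0 : forall z, integral_points z -> U z -> dot (a z) x0 < dot (a z) z.

Definition support_polyhedron (Q : set E) : set E :=
  U `&` [set x | forall z, Q z -> dot (a z) x <= dot (a z) z].

Local Notation T := support_polyhedron.

(** Every integral point of [T Q] attains equality in an inequality of [Q] that is strict at [x0],
    hence is not interior. So [T Q] is lattice-free and contains [C], and maximality concludes. *)
Lemma support_polyhedron_eq (Q : set E) :
  (forall z, Q z -> integral_points z /\ U z) ->
  (forall y, integral_points y -> T Q y -> exists2 z, Q z & dot (a z) z <= dot (a z) y) ->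
  T Q = C.
Proof.
move=> QU hQ; have TU : T Q `<=` U by move=> x [].
apply: max_lattice_freeE => //.
- apply/convexP => x y t [Ux Tx] [Uy Ty] t0 t1; split.
    exact: translate_conv.
  move=> z Qz; have := Tx z Qz; have := Ty z Qz; rewrite !dotE => h1 h2.
  have t1' : 0 <= 1 - t by rewrite subr_ge0.
  have := ler_wpM2l t0 h2; have := ler_wpM2l t1' h1; lra.
- by move=> x Cx; split=> [|z /QU[iz Uz]]; [exact: CU|exact: aC].
move=> y iy Iy; have [z Qz zy] := hQ y iy (interior_in_sub Iy).
have [iz Uz] := QU z Qz.
suff : dot (a z) y < dot (a z) z by rewrite ltNge zy.
apply: (interior_lt TU) Iy; first by move=> x [_]; apply.
exists (z - x0); first exact: translateB Uz (CU Cx0).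
by rewrite dotBr gt_eqF// subr_gt0 ax0.
Qed.

Let integral_U : set E := [set z | integral_points z /\ U z].

Lemma support_polyhedronT : T integral_U = C.
Proof. by apply: support_polyhedron_eq => // y iy [Uy _]; exists y. Qed.

(** A direction along which no supporting functional increases is a recession direction of [C], and
    [recession_opp] turns it into a line; hence one space has both descriptions. *)
Lemma lineality_space : exists2 N : {vspace E}, (N <= V)%VS &
  (forall r, r \in V -> (r \in N <-> forall x t, C x -> C (x + t *: r))) /\
  (forall r, r \in V -> (r \in N <-> forall z, integral_U z -> dot (a z) r <= 0)).
Proof.
have [|c x y [xV xC] [yV yC]|N NE] :=
    @subspace_vspace R n [set r | r \in V /\ forall x t, C x -> C (x + t *: r)].
- by split; [exact: mem0v|move=> x t; rewrite scaler0 addr0].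
- split; first by rewrite memvD// memvZ.
  move=> v t Cv; have -> : v + t *: (c *: x + y) = (v + (t * c) *: x) + t *: y by vec.
  exact/yC/xC.
exists N; first by apply/subvP => r /NE[].
split=> r rV; first by split=> [/NE[]//|h]; apply/NE.
split=> [/NE[_ rC] z [iz Uz]|h].
  rewrite leNgt; apply/negP => ar.
  (* This multiple of [r] would exceed the bound of the inequality by 1. *)
  have := aC iz Uz (rC x0 ((dot (a z) z - dot (a z) x0 + 1) / dot (a z) r) Cx0).
  rewrite !dotE divfK ?gt_eqF//; lra.
apply/NE; split => //; apply: recession_opp => // x t t0; rewrite -support_polyhedronT.
move=> [Ux Tx]; split; first by apply: translateD => //; rewrite memvZ.
move=> z Qz; rewrite !dotE; have := Tx z Qz; have := mulr_ge0_le0 t0 (h z Qz); lra.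
Qed.

(** * Compactness arguments modulo the lineality space *)

Section Projection.
Variable N : {vspace E}.
Hypothesis NV : (N <= V)%VS.
(** The projection with kernel [N]: [q x] represents the class of [x] modulo [N]. *)
Let q : 'End(E) := (\1 - projv N)%VF.

Let qE x : q x = x - projv N x.
Proof. by rewrite /q add_lfunE opp_lfunE id_lfunE. Qed.

Let subqN x : x - q x \in N.
Proof. by rewrite qE opprB addrC subrK memv_proj. Qed.

Let qN x : (q x == 0) = (x \in N).
Proof.
apply/idP/idP => [/eqP q0|xN]; first by rewrite -[x]subr0 -q0.
by rewrite qE projv_id// subrr.
Qed.

Let qV x : x \in V -> q x \in V.
Proof. by move=> xV; rewrite qE memvB// (subvP NV)// memv_proj. Qed.

(** A cluster point of unit vectors is nonzero, and by closedness it stays in [V] and in the kernel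
    of [projv N], which meets [N] only in 0. *)
Lemma direction_cluster (g : nat -> E) : (forall k, g k \in V) ->
  (forall k, q (g k) != 0) ->
  exists u, [/\ u \in V, u \notin N & forall e K, 0 < e ->
    exists k, (K <= k)%N /\ `| `|q (g k)|^-1 *: q (g k) - u| < e].
Proof.
move=> gV g0; pose x k := `|q (g k)|^-1 *: q (g k).
have x1 k : `|x k| = 1 by rewrite normrZ normfV normr_id mulVf ?normr_eq0.
have [k|u hu] := @cluster_point _ _ x 1; first by rewrite x1.
have u0 : u != 0.
  apply/eqP => u0; have [|k [_]] := hu 1 0%N; first by [].
  by rewrite u0 subr0 x1 ltxx.
have uN : u \notin N.
  rewrite -qN; have -> : q u = u; last by [].
  have : projv N u = 0.
    apply: limit_kernel => e e0; have [k [_ ku]] := hu e 0%N e0; exists (x k) => //.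
    by rewrite /x linearZ /= qE linearB /= projv_proj subrr scaler0.
  by rewrite qE => ->; rewrite subr0.
have uV : u \in V.
  have : (\1 - projv V : 'End(E))%VF u = 0.
    apply: limit_kernel => e e0; have [k [_ ku]] := hu e 0%N e0; exists (x k) => //.
    by rewrite add_lfunE opp_lfunE id_lfunE projv_id ?subrr// memvZ// qV.
  by rewrite add_lfunE opp_lfunE id_lfunE => /eqP; rewrite subr_eq0 => /eqP ->; exact: memv_proj.
by exists u; split => // e K; exact: hu.
Qed.

Hypothesis NC : forall r, r \in V -> (r \in N <-> forall x t, C x -> C (x + t *: r)).
Hypothesis Na : forall r, r \in V -> (r \in N <-> forall z, integral_U z -> dot (a z) r <= 0).

Let aN z r : integral_U z -> r \in N -> dot (a z) r = 0.
Proof.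
move=> Uz rN; have rV := subvP NV _ rN.
have nrN : - r \in N by rewrite memvN.
have := (Na rV).1 rN z Uz; have := (Na (subvP NV _ nrN)).1 nrN z Uz.
rewrite dotNr => h1 h2; apply/eqP; rewrite eq_le h2 /=; lra.
Qed.

Let aq z r : integral_U z -> dot (a z) (q r) = dot (a z) r.
Proof. by move=> Uz; apply/eqP; rewrite eq_sym -subr_eq0 -dotBr aN. Qed.

(** Otherwise some [y k] satisfies the inequalities of all integral points of [U] of norm at most
    [k], at distance more than [k] from [x0] modulo [N]. Each inequality holds for all large [k], so
    a limit direction of the [y k] satisfies all the homogeneous inequalities and lies in [N]. *)
Lemma bounded_mod_lineality : exists (s : seq E) c,
  (forall z, z \in s -> integral_U z) /\
  forall y, T [set` s] y -> `|q (y - x0)| <= c.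
Proof.
apply: contrapT => H.
pose box k := sval (cid (@integral_bounded R n k%:R)).
have boxP (k : nat) z : integral_points z -> `|z| <= k%:R -> z \in box k.
  by rewrite /box; case: cid => /= s; exact.
pose s k := [seq z <- box k | `[< integral_U z >]].
have sU k z : z \in s k -> integral_U z by rewrite mem_filter => /andP[/asboolP].
have yP k : exists y, T [set` s k] y /\ k%:R < `|q (y - x0)|.
  apply: contrapT => /forallNP h; apply: H; exists (s k), k%:R; split => [z /sU//|y Ty].
  by rewrite leNgt; apply/negP => yk; apply: (h y).
pose y k := sval (cid (yP k)).
have yT k : T [set` s k] (y k) by rewrite /y; case: cid => ? [].
have yk k : k%:R < `|q (y k - x0)| by rewrite /y; case: cid => ? [].
have q0 k : 0 < `|q (y k - x0)| by apply: le_lt_trans (yk k).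
have [k|k|u [uV uN hu]] := @direction_cluster (fun k => y k - x0).
- by have [Uy _] := yT k; exact: translateB Uy (CU Cx0).
- by rewrite -normr_gt0.
move/negP: uN; apply; apply/(Na uV) => z Uz; rewrite leNgt; apply/negP => au.
have [iz Uz'] := Uz; have az0 := ax0 iz Uz'.
pose A := 1 + \sum_i `|(a z) 0 i|; have A0 : 0 < A by rewrite ltr_pwDl// sumr_ge0.
pose D := dot (a z) z - dot (a z) x0.
(* From this index on, [z] belongs to [s k], and [k] times the slope of [dot (a z)] along [u]
   exceeds twice the slack [D]. *)
pose K := (Num.truncn (`|z| + 2 * D / dot (a z) u)).+1.
have [|k [Kk ku]] := hu (dot (a z) u / 2 / A) K; first by rewrite !divr_gt0.
have Kk' : `|z| + 2 * D / dot (a z) u < k%:R.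
  by apply: lt_le_trans (truncnS_gt _) _; rewrite ler_nat.
have D0 : 0 < D by rewrite subr_gt0.
have zs : z \in s k.
  rewrite mem_filter; apply/andP; split; first exact/asboolP.
  apply: boxP => //; apply/ltW/(le_lt_trans _ Kk').
  by rewrite lerDl ltW// divr_gt0// mulr_gt0.
have kD : 2 * D < dot (a z) u * k%:R.
  rewrite [ltRHS]mulrC -ltr_pdivrMr//; by apply: le_lt_trans Kk'; rewrite lerDr.
have [_ /(_ z zs) yz] := yT k.
have h1 : dot (a z) (q (y k - x0)) <= D by rewrite aq// dotBr lerD2r.
set v := q _ in ku h1; have v0 : k%:R < `|v| := yk k; have vp : 0 < `|v| := q0 k.
have h2 : `|dot (a z) (`|v|^-1 *: v - u)| < dot (a z) u / 2.
  apply: le_lt_trans (dot_le_norm _ _) _; move: ku; rewrite ltr_pdivlMr//; apply: le_lt_trans.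
  by rewrite mulrC ler_wpM2l// /A ler_wpDl.
move: h2; rewrite dotBr dotZr ltr_norml => /andP[h2 _].
have h3 : dot (a z) u / 2 < `|v|^-1 * dot (a z) v by lra.
have h4 : dot (a z) u / 2 * `|v| < D.
  by apply: lt_le_trans h1; rewrite -ltr_pdivlMr// [ltRHS]mulrC.
have h5 : dot (a z) u * k%:R < dot (a z) u * `|v| by rewrite ltr_pM2l.
lra.
Qed.

(** With infinitely many classes there would be lattice vectors [w k] that are nonzero but
    arbitrarily short modulo [N]. Their integer multiples approximate every [t *: u] modulo [N], for
    [u] a limit direction, and [recession_line] would put [u] in [N]. *)
Lemma finite_mod_lineality (s : seq E) c :
  (forall y, T [set` s] y -> `|q (y - x0)| <= c) ->
  exists s' : seq E, (forall z, z \in s' -> integral_U z) /\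
    forall y, integral_points y -> T [set` s] y -> exists2 z, z \in s' & y - z \in N.
Proof.
move=> Tc.
pose Y : set E := [set v | exists y, [/\ integral_points y, T [set` s] y & v = q (y - x0)]].
have [/finite_seqP[ys YE]|Yinf] := pselect (finite_set Y).
  have rep v : exists z, v \in ys -> integral_U z /\ v = q (z - x0).
    (* Outside [ys] the representative is the dummy value 0. *)
    have [vys|_] := boolP (v \in ys); last by exists 0.
    have : Y v by rewrite YE.
    by move=> [z [iz [Uz _] ->]]; exists z.
  pose f v := sval (cid (rep v)).
  have fP v : v \in ys -> integral_U (f v) /\ v = q (f v - x0) by rewrite /f; case: cid.
  exists [seq f v | v <- ys]; split=> [_ /mapP[v /fP[h _] ->]//|y iy Ty].
  have vys : q (y - x0) \in ys.
    have : Y (q (y - x0)) by exists y.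
    by rewrite YE.
  exists (f (q (y - x0))); first exact: map_f.
  rewrite -qN; have -> : y - f (q (y - x0)) = (y - x0) - (f (q (y - x0)) - x0) by vec.
  by rewrite linearB subr_eq0 /=; apply/eqP; case: (fP _ vys).
exfalso.
have wP (k : nat) : exists w, [/\ integral_points w, w \in V, q w != 0 & `|q w| < k.+1%:R^-1].
  have [||_ [_ [[y [iy [Uy _] ->]] [y' [iy' [Uy' _] ->]] yy' d]]] :=
    @infinite_close R n Y c k.+1%:R^-1 Yinf.
  - by move=> _ [y [_ Ty ->]]; exact: Tc.
  - by rewrite invr_gt0.
  have qB : q (y - y') = q (y - x0) - q (y' - x0).
    by rewrite -linearB; congr (q _); vec.
  exists (y - y'); rewrite qB subr_eq0; split => //; first exact: integralB.
  exact: translateB Uy Uy'.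
pose w k := sval (cid (wP k)).
have wk k : [/\ integral_points (w k), w k \in V, q (w k) != 0 & `|q (w k)| < k.+1%:R^-1].
  by rewrite /w; case: cid.
have [k|k|u [uV uN hu]] := @direction_cluster w; [by case: (wk k)|by case: (wk k)|].
move/negP: uN; apply; apply/(NC uV); apply: recession_line => // t e e0.
have e2 : 0 < e / 2 by rewrite divr_gt0.
have t1 : 0 < `|t| + 1 by rewrite ltr_pwDr.
have [|k [Kk ku]] := hu (e / 2 / (`|t| + 1)) (Num.truncn (e / 2)^-1).+1.
  by rewrite divr_gt0.
have [iw wV w0 wsmall] := wk k.
have wn0 : 0 < `|q (w k)| by rewrite normr_gt0.
(* Rounding makes [m *: q (w k)] differ from [t] times the unit vector of [q (w k)] by at most the
   norm of [q (w k)]. The other source of error is the distance from this unit vector to [u]. *)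
pose m := Num.floor (t / `|q (w k)|).
have wN : w k - q (w k) \in N by exact: subqN.
exists (m%:~R *: w k), (m%:~R *: (w k - q (w k))).
have mN : m%:~R *: (w k - q (w k)) \in N by rewrite memvZ.
have mV := subvP NV _ mN.
split => //; [exact: integralZ|by rewrite memvZ| |].
  by move=> x Cx; have := (NC mV).1 mN x 1 Cx; rewrite scale1r.
have -> : m%:~R *: w k - (t *: u + m%:~R *: (w k - q (w k))) =
    (m%:~R - t / `|q (w k)|) *: q (w k) + t *: (`|q (w k)|^-1 *: q (w k) - u) by vec.
apply: le_lt_trans (ler_normD _ _) _; rewrite !normrZ [ltRHS]splitr ltr_leD//.
  apply: le_lt_trans (ler_wpM2r (normr_ge0 _) (floor_dist _)) _.
  rewrite mul1r; apply: lt_trans wsmall _.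
  rewrite invf_plt ?posrE//; apply: lt_trans (truncnS_gt _) _.
  by rewrite ltr_nat ltnS.
apply: le_trans (ler_wpM2l (normr_ge0 _) (ltW ku)) _.
by rewrite mulrCA ger_pMr// ler_pdivrMr// mul1r lerDl.
Qed.

End Projection.

(** The points of [s] leave finitely many classes of integral points modulo [N], and those of [s']
    represent these classes. An integral point in the class of [z] is stopped by the inequality of
    [z], as the functional does not vary along [N]. *)
Lemma finite_support_polyhedron : exists s : seq E,
  (forall z, z \in s -> integral_U z) /\ T [set` s] = C.
Proof.
have [N NV [NC Na]] := lineality_space.
have [s [c [sU sc]]] := bounded_mod_lineality NV Na.
have [s' [sU' ss']] := finite_mod_lineality NV NC sc.
exists (s ++ s'); have ssU z : z \in s ++ s' -> integral_U z.
  by rewrite mem_cat => /orP[/sU|/sU'].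
split => //; apply: support_polyhedron_eq => // y iy [Uy Ty].
have [|z zs' yz] := ss' y iy.
  by split=> // z /= zs; apply: Ty; rewrite /= mem_cat zs.
exists z; first by rewrite /= mem_cat zs' orbT.
have zyN : z - y \in N by rewrite -opprB memvN.
have := (Na _ (subvP NV _ zyN)).1 zyN z (sU' _ zs').
by rewrite dotBr subr_le0.
Qed.

End MaximalPolyhedral.

(** * Facets of polyhedra *)

Section Facets.
Context {R : realType} {n : nat}.
Local Notation E := 'rV[R]_n.
Implicit Types (u v w x y : E) (c t : R) (B S F : set E).

Lemma hull_direction x B (X : seq E) u (d : R) : affine_hull B = translate x <<X>> ->
  B (x + d *: u) -> 0 < d -> u \in <<X>>%VS.
Proof.
move=> hB Bu d0; have : affine_hull B (x + d *: u) by exact: sub_affine_hull.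
rewrite hB => /translateP; rewrite addrC addKr => h.
have dn : d != 0 by rewrite gt_eqF.
by rewrite -[u]scale1r -(mulVf dn) -scalerA memvZ.
Qed.

Lemma interior_hull (z : E) (L : {vspace E}) B x : B `<=` translate z L ->
  interior_in (translate z L) B x -> affine_hull B = translate z L.
Proof.
move=> BL Ix; apply/seteqP; split; first exact: affine_hull_min.
have Bx := interior_in_sub Ix; have [X [_ hX]] := affine_hull_span Bx.
rewrite hX (translate_rebase (BL _ Bx)) => y /translateP yL; apply/translateP.
have [d d0 hd] := interior_push BL Ix yL.
by apply: (hull_direction hX _ d0); apply: interior_in_sub (hd d _); rewrite gtr0_norm.
Qed.

Lemma affine_hull_eq_dot B a c : (forall x, B x -> dot a x = c) ->
  forall x, affine_hull B x -> dot a x = c.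
Proof.
move=> Bc x [k [d [p [pB d1 ->]]]]; rewrite dot_sumr -[RHS]mul1r -d1 mulr_suml.
by apply: eq_bigr => i _; rewrite dotZr Bc.
Qed.

Lemma has_dim_hull_eq B B' d : B `<=` B' -> has_dim B d -> has_dim B' d ->
  affine_hull B = affine_hull B'.
Proof.
move=> BB [v [L [hB dL]]] [v' [L' [hB' dL']]].
have sub : affine_hull B `<=` affine_hull B'.
  by rewrite hB'; apply: affine_hull_min; rewrite -hB' => x /BB; exact: sub_affine_hull.
have hv : affine_hull B v by rewrite hB; exact: translate_base.
have hv' := sub _ hv; rewrite hB' in hv'.
rewrite hB hB' (translate_rebase hv'); congr translate; apply/eqP.
have LL : (L <= L')%VS.
  apply/subvP => x xL; have := sub (v + x); rewrite hB hB' => /(_ (translateD (translate_base _ _) xL)).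
  by move=> /translateB/(_ hv'); rewrite addrC addKr.
by rewrite -(dimv_leqif_eq LL) dL dL'.
Qed.

Lemma uniform_radius (I : eqType) (s : seq I) (Q : I -> R -> Prop) :
  (forall i, i \in s -> exists2 d : R, 0 < d & forall t, `|t| <= d -> Q i t) ->
  exists2 d : R, 0 < d & forall i t, i \in s -> `|t| <= d -> Q i t.
Proof.
elim: s => [|i s IH] h; first by exists 1.
have [|d d0 hd] := IH; first by move=> j js; apply: h; rewrite inE js orbT.
have [|d' d0' hd'] := h i; first by rewrite inE eqxx.
exists (Num.min d d'); first by rewrite lt_min d0.
move=> j t; rewrite inE le_min => /predU1P[->|js] /andP[td td']; first exact: hd'.
exact: hd.
Qed.

Section Polyhedron.
Variables (z : E) (L : {vspace E}) (I : finType) (a : I -> E) (b : I -> R).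
Local Notation U := (translate z L).
Implicit Types (J : {set I}) (i j : I).

Definition polyhedron J : set E :=
  U `&` [set x | forall i, i \in J -> dot (a i) x <= b i].

Definition irredundant J := forall i, i \in J -> exists y,
  [/\ U y, b i < dot (a i) y & forall j, j \in J -> j != i -> dot (a j) y <= b j].

Definition polyhedron_face J i := polyhedron J `&` [set x | dot (a i) x = b i].

Lemma polyhedron_sub J : polyhedron J `<=` U.
Proof. by move=> x []. Qed.

Lemma polyhedron_convex J : convex_set (polyhedron J).
Proof.
apply/convexP => x y t [Ux hx] [Uy hy] t0 t1; split; first exact: translate_conv.
move=> i iJ; rewrite !dotE; have t1' : 0 <= 1 - t by rewrite subr_ge0.
have := ler_wpM2l t0 (hx i iJ); have := ler_wpM2l t1' (hy i iJ); lra.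
Qed.

Lemma irredundant_subset J : exists J', [/\ {subset J' <= J},
  polyhedron J' = polyhedron J & irredundant J'].
Proof.
have [m] := ubnP #|J|; elim: m J => // m IH J; rewrite ltnS => Jm.
have [irr|/existsNP[i /not_implyP[iJ /forallNP hi]]] := pselect (irredundant J).
  by exists J; split.
have [|J' [JJ PJ irr]] := IH (J :\ i).
  by move: Jm; rewrite (cardsD1 i) iJ.
exists J'; split => //; first by move=> j /JJ; rewrite in_setD1 => /andP[].
rewrite PJ; apply/seteqP; split=> x [Ux hx]; split => //.
  move=> j jJ; have [->|ji] := eqVneq j i; last by apply: hx; rewrite in_setD1 ji.
  rewrite leNgt; apply/negP => bi; apply: (hi x); split => // k kJ ki.
  by apply: hx; rewrite in_setD1 ki.
by move=> j; rewrite in_setD1 => /andP[_]; exact: hx.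
Qed.

Lemma strict_push J x v : (forall i, i \in J -> dot (a i) x < b i) ->
  exists2 d : R, 0 < d & forall i t, i \in J -> `|t| <= d -> dot (a i) (x + t *: v) < b i.
Proof.
move=> hx; have [i|d d0 hd] := @uniform_radius I (enum J) (fun i t => dot (a i) (x + t *: v) < b i).
  rewrite mem_enum => iJ; have bi := hx i iJ.
  have a1 : 0 < `|dot (a i) v| + 1 by rewrite ltr_pwDr.
  exists ((b i - dot (a i) x) / 2 / (`|dot (a i) v| + 1)).
    by rewrite !divr_gt0// subr_gt0.
  move=> t; rewrite ler_pdivlMr// => ht; rewrite !dotE.
  have := ler_norm (t * dot (a i) v); rewrite normrM.
  have := normr_ge0 t; lra.
by exists d => // i t iJ; apply: hd; rewrite mem_enum.
Qed.

Lemma strict_interior J x : U x -> (forall i, i \in J -> dot (a i) x < b i) ->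
  interior_in U (polyhedron J) x.
Proof.
move=> Ux hx; apply: core_interior; [exact: polyhedron_sub|exact: polyhedron_convex| |].
  by split=> // i /hx/ltW.
move=> u uL; have [d d0 hd] := strict_push u hx; exists d => //; split.
  by apply: translateD => //; rewrite memvZ.
by move=> i iJ; apply/ltW/hd => //; rewrite gtr0_norm.
Qed.

(** Midpoints are taken successively: an inequality that is strict at one end and weak at the other
    is strict at the midpoint. *)
Lemma convex_strict_point J B : convex_set B -> B !=set0 -> B `<=` polyhedron J ->
  (forall i, i \in J -> exists2 p, B p & dot (a i) p < b i) ->
  exists2 p, B p & forall i, i \in J -> dot (a i) p < b i.
Proof.
move=> cB [p0 Bp0] BP hp.
suff [p Bp h] : exists2 p, B p & forall i, i \in enum J -> dot (a i) p < b i.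
  by exists p => // i iJ; apply: h; rewrite mem_enum.
have : {subset enum J <= J} by move=> i; rewrite mem_enum.
elim: (enum J) => [|i s IH] sJ; first by exists p0.
have [|p Bp hps] := IH; first by move=> j js; apply: sJ; rewrite inE js orbT.
have [|q Bq qi] := hp i; first by apply: sJ; rewrite inE eqxx.
have [h0 h1] : 0 <= 2^-1 :> R /\ 2^-1 <= 1 :> R by split; lra.
exists (2^-1 *: p + (1 - 2^-1) *: q); first by move/convexP: cB; apply.
have [_ hP] := BP _ Bp; have [_ hQ] := BP _ Bq.
move=> j js; have jJ := sJ j js; have := hP j jJ; have := hQ j jJ; rewrite !dotE.
move: js; rewrite inE => /predU1P[ji|/hps]; last by lra.
by move: qi; rewrite -ji; lra.
Qed.

Lemma irredundant_direction J i x0 : polyhedron J x0 -> irredundant J -> i \in J ->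
  exists2 u, u \in L & dot (a i) u != 0.
Proof.
move=> [Ux0 h0] irr iJ; have [y [Uy yi _]] := irr i iJ.
exists (y - x0); first exact: translateB Uy Ux0.
by rewrite dotBr gt_eqF// subr_gt0 (le_lt_trans (h0 i iJ)).
Qed.

Variables (J : {set I}) (x0 : E).
Hypotheses (irr : irredundant J) (Ux0 : U x0)
  (strict : forall i, i \in J -> dot (a i) x0 < b i).
Local Notation P := (polyhedron J).
Local Notation face_ := (polyhedron_face J).

(** The point where inequality [i] becomes tight on the segment from [x0] to an irredundancy witness
    [y]: the other inequalities are strict at [x0] and weak at [y]. *)
Lemma facet_point i : i \in J -> exists x, [/\ U x, dot (a i) x = b i &
  forall j, j \in J -> j != i -> dot (a j) x < b j].
Proof.
move=> iJ; have [y [Uy yi yj]] := irr iJ.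
have d0 : 0 < dot (a i) y - dot (a i) x0 by rewrite subr_gt0 (lt_trans (strict iJ)).
have dn : dot (a i) y - dot (a i) x0 != 0 by rewrite gt_eqF.
pose t := (b i - dot (a i) x0) / (dot (a i) y - dot (a i) x0).
have t0 : 0 <= t by rewrite divr_ge0 ?(ltW d0)// subr_ge0 ltW// strict.
have t1 : t < 1 by rewrite ltr_pdivrMr// mul1r ltrD2r.
exists (x0 + t *: (y - x0)); split.
- by apply: translateD => //; rewrite memvZ// (translateB Uy).
- by rewrite !dotE /t; field.
move=> j jJ ji; rewrite !dotE.
have h1 := ler_wpM2l t0 (yj j jJ ji).
have t1' : 0 < 1 - t by rewrite subr_gt0.
have := strict jJ; rewrite -(ltr_pM2l t1'); lra.
Qed.

Lemma face_point i x : i \in J -> U x -> dot (a i) x = b i ->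
  (forall j, j \in J -> j != i -> dot (a j) x < b j) -> face_ i x.
Proof.
move=> iJ Ux xi xj; split => //; split => // j jJ.
by have [->|ji] := eqVneq j i; [rewrite xi|exact/ltW/xj].
Qed.

(** From the point of [facet_point], every direction of [L] in the kernel of [dot (a i)] can be
    followed inside the face. *)
Lemma polyhedron_face_dim i : i \in J -> exists d, \dim L = d.+1 /\ has_dim (face_ i) d.
Proof.
move=> iJ; have [x [Ux xi xj]] := facet_point iJ.
have Fx : face_ i x by exact: face_point.
have Px0 : P x0 by split => // j /strict/ltW.
have [L' [LE dL]] := hyperplane_dim (irredundant_direction Px0 irr iJ).
exists (\dim L'); split; first by rewrite dL.
exists x, L'; split => //; apply/seteqP; split.
  apply: affine_hull_min => y [[Uy _] yi]; apply/translateP/LE.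
  by split; [exact: translateB Uy Ux|rewrite dotBr yi xi subrr].
have [X [_ hX]] := affine_hull_span Fx.
move=> y /translateP/LE[yL ya]; rewrite hX; apply/translateP.
have [|d d0 hd] := @strict_push (J :\ i) x (y - x).
  by move=> j; rewrite in_setD1 => /andP[ji jJ]; exact: xj.
apply: (hull_direction hX _ d0); apply: face_point => //.
- by apply: translateD => //; rewrite memvZ.
- by rewrite dotDr dotZr ya mulr0 addr0.
- by move=> j jJ ji; apply: hd; [rewrite in_setD1 ji|rewrite gtr0_norm].
Qed.

Lemma polyhedron_dim : has_dim P (\dim L).
Proof.
by exists z, L; split => //; apply: (interior_hull (x := x0)); [exact: polyhedron_sub|exact: strict_interior].
Qed.

(** If no inequality were tight on all of a facet [F], some point of [F] would be interior to the
    polyhedron, making [F] equal to it. So [F] lies in some [face_ i], and by equality of dimensions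
    both have the same affine hull. *)
Lemma facets_polyhedron : facets P = [set face_ i | i in [set` J]].
Proof.
apply/seteqP; split => [F [[u [c [uc FE]]] [d [dP dF]]]|_ [i /= iJ <-]]; last first.
  split; first by exists (a i), (b i); split => // x [_]; exact.
  have [d [dL dF]] := polyhedron_face_dim iJ; exists d; split => //.
  by rewrite -dL; exact: polyhedron_dim.
have FP : F `<=` P by rewrite FE => x [].
have cF : convex_set F.
  apply/convexP => x y t; rewrite FE => -[Px /= xc] [Py /= yc] t0 t1; split.
    by move/convexP: (@polyhedron_convex J); apply.
  by rewrite /= !dotE xc yc -mulrDl addrC subrK mul1r.
have [i iJ Fi] : exists2 i, i \in J & forall p, F p -> dot (a i) p = b i.
  apply: contrapT => H.
  have [i iJ|p Fp ps] := convex_strict_point cF (has_dim_nonempty dF) FP.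
    apply: contrapT => H'; apply: H; exists i => // p Fp; apply/eqP.
    have [_ /(_ i iJ) le] := FP p Fp; rewrite eq_le le /= leNgt; apply/negP => lt.
    by apply: H'; exists p.
  have [Pp /= pc] : (P `&` [set x | dot u x = c]) p by rewrite -FE.
  have Up : U p := polyhedron_sub Pp.
  have uL v : v \in L -> dot u v = 0.
    move=> vL; apply/eqP; apply: contrapT => /negP uv.
    have := interior_lt (@polyhedron_sub J) uc (ex_intro2 _ _ v vL uv) (strict_interior Up ps).
    by rewrite pc ltxx.
  have PF : P = F.
    rewrite FE; apply/seteqP; split => x; last by case.
    move=> Px; split => //=; rewrite -pc; apply/eqP; rewrite -subr_eq0 -dotBr uL//.
    exact: translateB (polyhedron_sub Px) Up.
  by move: dP; rewrite PF => /has_dim_uniq/(_ dF)/eqP; rewrite -[_ == _]/(d.+1 == d) gtn_eqF.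
exists i => //; apply/seteqP; split; last by move=> x Fx; split; [exact: FP|exact: Fi].
have [d' [dL dFi]] := polyhedron_face_dim iJ.
have dd : d = d' by apply: succn_inj; rewrite -dL; exact: has_dim_uniq dP polyhedron_dim.
rewrite -dd in dFi; have FFi : F `<=` face_ i by move=> x Fx; split; [exact: FP|exact: Fi].
move=> x Fx; rewrite FE; split; first by case: Fx.
have Fc y : F y -> dot u y = c by rewrite FE => -[].
apply: (affine_hull_eq_dot Fc); rewrite (has_dim_hull_eq FFi dF dFi).
exact: sub_affine_hull.
Qed.

Lemma polyhedron_face_inj i j : i \in J -> j \in J -> face_ i `<=` face_ j -> i = j.
Proof.
move=> iJ jJ ij; have [x [Ux xi xj]] := facet_point iJ.
have [_ /= e] := ij _ (face_point iJ Ux xi xj).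
by apply/eqP; apply: contraT; rewrite eq_sym => /(xj j jJ); rewrite e ltxx.
Qed.

End Polyhedron.
End Facets.

(** * Lattice-free sets of an affine space and of its lattice hull *)

Section HalfSpaces.
Context {R : realType} {n : nat}.
Local Notation E := 'rV[R]_n.
Implicit Types (a u v w x y z : E) (L : {vspace E}) (c t e : R) (U B S : set E).

Lemma lattice_freeP U B : lattice_free_convex U B <->
  [/\ B `<=` U, convex_set B & forall y, integral_points y -> ~ interior_in U B y].
Proof.
split=> -[BU cB h]; split=> //.
  by move=> y iy Iy; have : (interior_in U B `&` integral_points) y by []; rewrite h.
by rewrite -subset0 => y [Iy /h].
Qed.

Lemma interior_mono U B B' x : U x -> B `<=` B' -> interior_in U B x -> interior_in U B' x.
Proof.
move=> Ux BB /(interior_inP _ Ux)[e e0 h]; apply/interior_inP => //.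
by exists e => // y Uy yx; exact/BB/h.
Qed.

Lemma half_space_convex v L a c : convex_set (translate v L `&` [set x | dot a x <= c]).
Proof.
apply/convexP => x y t [Ux /= hx] [Uy /= hy] t0 t1; split; first exact: translate_conv.
rewrite /= !dotE; have t1' : 0 <= 1 - t by rewrite subr_ge0.
have := ler_wpM2l t0 hx; have := ler_wpM2l t1' hy; lra.
Qed.

Lemma dot_near a x e : 0 < e -> exists2 d : R, 0 < d &
  forall y, `|y - x| < d -> `|dot a y - dot a x| < e.
Proof.
move=> e0; pose A := 1 + \sum_i `|a 0 i|.
have A0 : 0 < A by rewrite ltr_pwDl// sumr_ge0.
exists (e / A); first exact: divr_gt0.
move=> y; rewrite ltr_pdivlMr// -dotBr => yx.
apply: le_lt_trans (dot_le_norm _ _) (le_lt_trans _ yx).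
by rewrite mulrC ler_wpM2l// /A ler_wpDl.
Qed.

(** The ray from [p] through a point of the strip continues to a point of [B] at level [c], so the
    whole open strip lies in [B]. *)
Lemma strip_interior v L B a c p x : B `<=` translate v L -> convex_set B ->
  translate v L `&` [set y | dot a y = c] `<=` B -> B p -> translate v L x ->
  c < dot a x < dot a p -> interior_in (translate v L) B x.
Proof.
move=> BL cB HB Bp Lx /andP[cx xp].
have strip y : translate v L y -> c < dot a y < dot a p -> B y.
  move=> Ly /andP[cy yp]; have Lp := BL _ Bp.
  have d0 : 0 < dot a p - dot a y by lra.
  have d1 : 0 < dot a p - c by lra.
  pose t := (dot a p - dot a y) / (dot a p - c).
  have t0 : 0 < t by exact: divr_gt0.
  have -> : y = p + t *: (t^-1 *: (y - p)).
    by rewrite scalerA divff ?gt_eqF// scale1r; vec.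
  apply: convex_step => //; last by rewrite ltW//= ler_pdivrMr// mul1r; lra.
  apply: HB; split; first by apply: translateD => //; rewrite memvZ// (translateB Ly).
  by rewrite /= !dotE /t; field; rewrite !gt_eqF.
apply/interior_inP => //.
have [|d d0 hd] := @dot_near a x (Num.min (dot a x - c) (dot a p - dot a x)).
  by rewrite lt_min !subr_gt0 cx.
exists d => // y Ly /hd; rewrite lt_min !ltr_norml => /andP[/andP[h1 h2] /andP[h3 h4]].
by apply: strip => //; apply/andP; split; lra.
Qed.

Lemma half_space_interior v L a c x : translate v L x -> dot a x < c ->
  interior_in (translate v L) (translate v L `&` [set y | dot a y <= c]) x.
Proof.
move=> Lx xc; apply/interior_inP => //.
have [|d d0 hd] := @dot_near a x (c - dot a x); first by rewrite subr_gt0.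
exists d => // y Ly /hd; rewrite ltr_norml => /andP[_ h]; split => //=; lra.
Qed.

Lemma closure_half_space v L a c x : translate v L x ->
  closure ((translate v L `&` [set y | dot a y <= c]) : set (subspace (translate v L))) x ->
  dot a x <= c.
Proof.
move=> Lx clx; rewrite leNgt; apply/negP => cx.
have [|d d0 hd] := @dot_near a x (dot a x - c); first by rewrite subr_gt0.
have [|y [[_ /= yc] yx]] := clx [set y | `|y - x| < d].
  by apply/nbhs_subspace_ballP => //; exists d.
have := hd y yx; rewrite ltr_norml => /andP[h _]; lra.
Qed.

Lemma hyperplane_level v L a c : (exists2 u, u \in L & dot a u != 0) ->
  exists w L', [/\ translate v L w, dot a w = c,
    translate v L `&` [set x | dot a x = c] = translate w L',
    (forall x, x \in L' <-> x \in L /\ dot a x = 0) & (\dim L').+1 = \dim L].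
Proof.
move=> [u uL au]; have [L' [LE dL]] := hyperplane_dim (ex_intro2 _ _ u uL au).
pose w := v + ((c - dot a v) / dot a u) *: u.
have Lw : translate v L w by apply: translateD; [exact: translate_base|rewrite memvZ].
have aw : dot a w = c by rewrite /w !dotE divfK// addrC subrK.
exists w, L'; split => //; apply/seteqP; split=> x.
  move=> [Lx /= ax]; apply/translateP/LE; split; first exact: translateB Lx Lw.
  by rewrite dotBr ax aw subrr.
move=> /translateP/LE[xL]; rewrite dotBr aw => /eqP; rewrite subr_eq0 => /eqP ax; split => //.
by have := translateD Lw xL; rewrite addrC subrK.
Qed.

Lemma hyperplane_level_of v L a c : (exists2 u, u \in L & dot a u != 0) ->
  affine_hyperplane_of (translate v L) (translate v L `&` [set x | dot a x = c]).
Proof.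
move=> /(@hyperplane_level v L a c)[w [L' [_ _ HE _ dL]]]; split => //.
- by exists w, L'.
- by exists (\dim L'); rewrite HE dL; split; exact: has_dim_translate.
Qed.

(** The nonempty level set of a functional constant on [L] is the whole space, which has the wrong
    dimension. *)
Lemma nonconstant_level v L a c :
  affine_hyperplane_of (translate v L) (translate v L `&` [set x | dot a x = c]) ->
  exists2 u, u \in L & dot a u != 0.
Proof.
move=> [_ _ [d [dW dH]]]; apply: contrapT => H.
have aL u : u \in L -> dot a u = 0.
  by move=> uL; apply/eqP; apply: contrapT => /negP au; apply: H; exists u.
have [w [Lw /= wc]] := has_dim_nonempty dH.
have HE : translate v L `&` [set x | dot a x = c] = translate v L.
  apply/seteqP; split => x; first by case.
  move=> Lx; split => //=; rewrite -wc; apply/eqP; rewrite -subr_eq0 -dotBr aL//.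
  exact: translateB Lx Lw.
by move: dH; rewrite HE => /(has_dim_uniq dW)/eqP; rewrite gtn_eqF.
Qed.

Lemma convex_pair B x y c t : convex_set B -> B x -> B y -> 0 <= c -> 0 <= t ->
  exists2 w, B w & c *: x + t *: y = (c + t) *: w.
Proof.
move=> cB Bx By c0 t0; have [ct|ct] := eqVneq (c + t) 0.
  exists x => //; have [-> ->] : c = 0 /\ t = 0 by split; lra.
  by rewrite !scale0r addr0 addr0 scale0r.
have ct0 : 0 < c + t by rewrite lt_neqAle eq_sym ct addr_ge0.
exists ((c / (c + t)) *: x + (1 - c / (c + t)) *: y).
  move/convexP: cB; apply => //; first by rewrite divr_ge0// ltW.
  by rewrite ler_pdivrMr// mul1r lerDl.
by apply/rowP => i; rewrite !mxE; field.
Qed.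

(** For nonempty convex [A] and [B] this is the convex hull of their union. *)
Definition convex_join (A B : set E) : set E := [set x | exists s b t,
  [/\ A s, B b, 0 <= t <= 1 & x = t *: s + (1 - t) *: b]].

Lemma convex_join_convex (A B : set E) : convex_set A -> convex_set B ->
  convex_set (convex_join A B).
Proof.
move=> cA cB; apply/convexP => _ _ t [s [b [r [As Bb /andP[r0 r1] ->]]]]
  [s' [b' [r' [As' Bb' /andP[r0' r1'] ->]]]] t0 t1.
have t1' : 0 <= 1 - t by rewrite subr_ge0.
have k1' : 0 <= 1 - r by rewrite subr_ge0.
have k2' : 0 <= 1 - r' by rewrite subr_ge0.
have [w Aw wE] := convex_pair cA As As' (mulr_ge0 t0 r0) (mulr_ge0 t1' r0').
have [y By yE] := convex_pair cB Bb Bb' (mulr_ge0 t0 k1') (mulr_ge0 t1' k2').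
exists w, y, (t * r + (1 - t) * r'); split => //.
  rewrite addr_ge0 ?mulr_ge0//=.
  have := mulr_ge0 t0 k1'; have := mulr_ge0 t1' k2'; lra.
have -> : 1 - (t * r + (1 - t) * r') = t * (1 - r) + (1 - t) * (1 - r') by ring.
by rewrite -wE -yE; vec.
Qed.

End HalfSpaces.

(** * Maximality of the three kinds of sets *)

Section Main.
Context {R : realType} {n : nat}.
Local Notation E := 'rV[R]_n.
Implicit Types (a u v w x y z p : E) (L : {vspace E}) (c t e : R) (B S : set E).
Variables (z0 : E) (M N : {vspace E}).
Local Notation W := (translate z0 M).
Local Notation V := (translate z0 N).
Hypotheses (iz0 : integral_points z0) (NM : (N <= M)%VS) (sN : spanned_by_integral N).
Hypothesis ZV : forall y, integral_points y -> W y -> V y.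

Let VW : V `<=` W.
Proof. by move=> x /translateP xN; apply/translateP; exact: (subvP NM). Qed.

Lemma interior_restrict S x : interior_in W S x -> V x -> interior_in V (S `&` V) x.
Proof.
move=> Ix Vx; have [e e0 h] := (interior_inP S (VW Vx)).1 Ix.
by apply/interior_inP => //; exists e => // y Vy yx; split => //; apply: h => //; exact: VW.
Qed.

(** [y] lies strictly between [x0] and a point of [S] chosen slightly beyond [y]. *)
Lemma interior_extend S x0 y : S `<=` W -> convex_set S -> interior_in W S x0 -> V x0 ->
  interior_in V (S `&` V) y -> interior_in W S y.
Proof.
move=> SW cS Ix0 Vx0 Iy; have [_ Vy] := interior_in_sub Iy.
have SV : S `&` V `<=` V by move=> x [].
have [d d0 hd] := interior_push SV Iy (translateB Vy Vx0).
have [|Sy' _] := interior_in_sub (hd d _); first by rewrite gtr0_norm.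
have d1 : 0 < 1 + d by rewrite addr_gt0.
have -> : y = x0 + (1 + d)^-1 *: (y + d *: (y - x0) - x0).
  by apply/rowP => i; rewrite !mxE; field; rewrite gt_eqF.
by apply: interior_convex_step => //; rewrite invr_ge0 ltW//= invf_lt1// ltrDl.
Qed.

Lemma half_space_maximal S : closed_half_space_of W S -> V `<=` boundary_in W S ->
  maximal_lattice_free_convex W S.
Proof.
move=> [a [c [Hac SE]]] VS; have nca := nonconstant_level Hac.
have SW : S `<=` W by rewrite SE => x [].
split; first apply/lattice_freeP; first split => //.
- by rewrite SE; exact: half_space_convex.
- move=> y iy Iy; have Vy : V y by apply: ZV => //; exact: SW (interior_in_sub Iy).
  by have [_] := VS _ Vy.
move=> B /lattice_freeP[BW cB fB] SB; apply/seteqP; split => // p Bp.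
have Wz0 : W z0 by exact: translate_base.
have [clz0 nz0] := VS z0 (translate_base _ _).
have az0 : dot a z0 = c.
  apply/eqP; rewrite eq_le; apply/andP; split.
    by apply: closure_half_space Wz0 _; rewrite -SE.
  rewrite leNgt; apply/negP => zc; apply: nz0.
  by rewrite SE; exact: half_space_interior.
rewrite SE; split; first exact: BW.
rewrite /= leNgt; apply/negP => cp; apply: (fB z0 iz0).
(* Level [c - 1] is contained in [S], and [z0], at level [c], lies strictly between it and [p]. *)
apply: (@strip_interior _ _ _ _ _ a (c - 1) p) => //; last by rewrite az0 cp andbT; lra.
by move=> x [Wx /= xc]; apply: SB; rewrite SE; split => //=; lra.
Qed.

(** The values of [dot a] on the lattice vectors of [N] form a subgroup [G]. If it is not dense, it
    is generated by its least positive element [al], attained at [l0]; subtracting multiples of [l0]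
    from the generators of [N] then gives lattice vectors that span the kernel, against
    irrationality. *)
Lemma integral_values_dense a c c' : (exists2 u, u \in N & dot a u != 0) ->
  (forall K : {vspace E}, (forall x, x \in K <-> x \in N /\ dot a x = 0) ->
    [set` K] <> linear_span ([set` K] `&` integral_points)) ->
  c < c' -> exists y, [/\ integral_points y, V y & c < dot a y < c'].
Proof.
move=> [u0 u0N au0] irr cc; have [X iX NX] := sN.
pose G : set R := [set dot a w | w in [set w | integral_points w /\ w \in N]].
have GB g h : G g -> G h -> G (g - h).
  move=> [w [iw wN] <-] [y [iy yN] <-]; exists (w - y); last by rewrite dotBr.
  by split; [exact: integralB|rewrite memvB].
have GZ g (m : int) : G g -> G (m%:~R * g).
  move=> [w [iw wN] <-]; exists (m%:~R *: w); last by rewrite dotZr.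
  by split; [exact: integralZ|rewrite memvZ].
apply: contrapT => H.
(* A positive element of [G] smaller than the length of the interval has a multiple that, added to
   the value at [z0], falls into it. *)
have gap g : G g -> 0 < g -> c' - c <= g.
  move=> Gg g0; rewrite leNgt; apply/negP => gc.
  pose m := Num.floor ((c - dot a z0) / g) + 1.
  have [w [iw wN] wg] := GZ g m Gg; apply: H; exists (z0 + w); split.
  - exact: integralD.
  - exact: translateD (translate_base _ _) wN.
  rewrite dotDr wg.
  have := floorD1_gt ((c - dot a z0) / g); have := floor_le ((c - dot a z0) / g).
  rewrite -/m ler_pdivlMr// ltr_pdivrMr// => h1 h2.
  have mE : m%:~R * g = (Num.floor ((c - dot a z0) / g))%:~R * g + g.
    by rewrite /m intrD mulrDl mul1r.
  by apply/andP; split; lra.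
pose P : set R := [set g | G g /\ 0 < g].
have [g0 Pg0] : P !=set0.
  have [w wX aw] : exists2 w, w \in X & dot a w != 0.
    apply: contrapT => H'; move/negP: au0; apply; move: u0N; rewrite NX => /span_coordP[d ->].
    rewrite dot_sumr big1// => i _; rewrite dotZr; apply/eqP; rewrite mulf_eq0; apply/orP; right.
    by apply: contrapT => /negP aX; apply: H'; exists X`_i => //; exact: mem_nth.
  have Gw : G (dot a w) by exists w => //; split; [exact: iX|rewrite NX memv_span].
  have := aw; rewrite neq_lt => /orP[w0|w0]; last by exists (dot a w).
  exists (- dot a w); split; last by rewrite oppr_gt0.
  by have := GZ _ (-1) Gw; rewrite mulN1r.
have infP : has_inf P by split; [exists g0|exists 0 => g [_ /ltW]].
have d0 : 0 < c' - c by rewrite subr_gt0.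
pose al := inf P.
have lbP g : P g -> al <= g by apply: ge_inf; case: infP.
(* The infimum is attained, since otherwise two elements of [P] near it would differ by less than
   the gap. *)
have Pal : P al.
  have [g Pg gal] := inf_adherent d0 infP.
  suff <- : g = al by [].
  apply/eqP; rewrite eq_le lbP// andbT leNgt; apply/negP => alg.
  have [g' Pg' gg'] : exists2 g', P g' & g' < g.
    apply: contrapT => H'; move: alg; rewrite ltNge => /negP; apply.
    apply: lb_le_inf; first by exists g0.
    by move=> h Ph; rewrite leNgt; apply/negP => hg; apply: H'; exists h.
  have := gap (g - g') (GB _ _ Pg.1 Pg'.1); rewrite subr_gt0 => /(_ gg').
  have := lbP _ Pg'; lra.
have [[l0 [il0 l0N] al0] alp] := Pal.
have mult w : integral_points w -> w \in N -> exists m : int, dot a w = m%:~R * al.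
  move=> iw wN; pose m := Num.floor (dot a w / al); exists m.
  have Gr : G (dot a w - m%:~R * al).
    by apply: GB; [exists w|apply: GZ; case: Pal].
  have := floorD1_gt (dot a w / al); have := floor_le (dot a w / al).
  rewrite -/m ler_pdivlMr// ltr_pdivrMr// intrD mulrDl mul1r => h1 h2.
  apply/eqP; rewrite -subr_eq0 eq_le subr_ge0 h1 andbT leNgt; apply/negP => r0.
  have := lbP _ (conj Gr r0); lra.
have [K [KE _]] := hyperplane_dim (ex_intro2 _ _ u0 u0N au0).
apply: (irr K KE); apply/seteqP; split => x; last first.
  move=> [k [d [p [pK ->]]]]; apply: memv_suml => i _; rewrite memvZ//.
  by have [] := pK i.
move=> /= /KE[]; rewrite {1}NX => /span_coordP[d xE] ax.
have Xint (i : 'I_(size X)) : integral_points X`_i /\ X`_i \in N.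
  by split; [exact/iX/mem_nth|rewrite NX memv_span// mem_nth].
have mX (i : 'I_(size X)) := mult _ (Xint i).1 (Xint i).2.
pose m i := sval (cid (mX i)).
have mE (i : 'I_(size X)) : dot a X`_i = (m i)%:~R * al by rewrite /m; case: cid.
exists (size X), d, (fun i : 'I_(size X) => X`_i - (m i)%:~R *: l0); split.
  move=> i; split; last by apply: integralB; [exact: (Xint i).1|exact: integralZ].
  apply/KE; split; first by rewrite memvB ?memvZ//; exact: (Xint i).2.
  by rewrite dotBr dotZr mE al0 subrr.
(* This sum is the total coefficient of [l0] in the corrections of the generators. *)
have s0 : \sum_i d i * (m i)%:~R = 0 :> R.
  move: ax; rewrite xE dot_sumr (eq_bigr (fun i : 'I_(size X) => (d i * (m i)%:~R) * al)) => [|i _].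
    by rewrite -mulr_suml => /eqP; rewrite mulf_eq0 (gt_eqF alp) orbF => /eqP.
  by rewrite dotZr mE mulrA.
rewrite (eq_bigr (fun i : 'I_(size X) => d i *: X`_i - (d i * (m i)%:~R) *: l0)) => [|i _].
  by rewrite sumrB -scaler_suml s0 scale0r subr0.
by rewrite scalerBr scalerA.
Qed.

(** [S] is a level set of a functional whose kernel on [N] is irrational, so between its level and
    that of a further point [p] there is the level of an integral point, which becomes interior. *)
Lemma irrational_hyperplane_maximal S v L : affine_hyperplane_of W S -> S v ->
  S = translate v L -> irrational_hyperplane_of N (L :&: N)%VS ->
  maximal_lattice_free_convex W S.
Proof.
move=> [_ SW [d [dW dS]]] Sv SE [_ dLN irr].
have Wv := SW _ Sv.
have dM : \dim M = d.+1 by exact: has_dim_uniq (has_dim_translate _ _) dW.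
have dL : \dim L = d by move: dS; rewrite SE; exact: has_dim_uniq (has_dim_translate _ _).
have LM : (L <= M)%VS.
  apply/subvP => x xL; have := SW (v + x); rewrite SE => /(_ (translateD (translate_base _ _) xL)).
  by move=> /translateB/(_ Wv); rewrite addrC addKr.
have [|a [u [uM au aL]]] := hyperplane_functional LM; first by rewrite dL dM.
have nca : exists2 u, u \in M & dot a u != 0 by exists u; rewrite // au oner_neq0.
have SH : S = W `&` [set x | dot a x = dot a v].
  rewrite SE; apply/seteqP; split => x.
    move=> Lx; split; first by apply: SW; rewrite SE.
    by move/translateP: Lx => /aL[_]; rewrite /= dotBr => /eqP; rewrite subr_eq0 => /eqP.
  move=> [Wx /= ax]; apply/translateP/aL; split; first exact: translateB Wx Wv.
  by rewrite dotBr ax subrr.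
have ncN : exists2 u, u \in N & dot a u != 0.
  apply: contrapT => H; move: dLN; suff -> : (L :&: N = N)%VS by move/eqP; rewrite gtn_eqF.
  apply/capv_idPr/subvP => x xN; apply/aL; split; first exact: (subvP NM).
  by apply/eqP; apply: contrapT => /negP ax; apply: H; exists x.
have KLN (K : {vspace E}) : (forall x, x \in K <-> x \in N /\ dot a x = 0) -> K = (L :&: N)%VS.
  move=> KE; apply/vspaceP => x; rewrite memv_cap; apply/idP/idP.
    by move/KE => [xN ax]; rewrite xN andbT; apply/aL; split => //; exact: (subvP NM).
  by move=> /andP[/aL[_ ax] xN]; apply/KE.
split; first apply/lattice_freeP; first split => //.
- by rewrite SE; exact: translate_convex.
- move=> y _ Iy; have : dot a y < dot a v.
    by apply: interior_lt SW _ nca Iy => x; rewrite SH => -[_ /= ->].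
  by have := interior_in_sub Iy; rewrite SH => -[_ /= ->]; rewrite ltxx.
move=> B /lattice_freeP[BW cB fB] SB; apply/seteqP; split => // p Bp; rewrite SH.
split; first exact: BW.
apply/eqP; apply: contraT; rewrite neq_lt => /orP[pv|pv]; exfalso.
  have [y [iy Vy /andP[py yv]]] : exists y, [/\ integral_points y, V y & dot a p < dot a y < dot a v].
    by apply: integral_values_dense => // K /KLN ->.
  apply: (fB y iy); apply: (@strip_interior _ _ _ _ _ (- a) (- dot a v) p) => //.
  - by move=> x [Wx /=]; rewrite dotNl => /oppr_inj ax; apply: SB; rewrite SH.
  - exact: VW.
  - by rewrite !dotNl !ltrN2 yv py.
have [y [iy Vy ypv]] : exists y, [/\ integral_points y, V y & dot a v < dot a y < dot a p].
  by apply: integral_values_dense => // K /KLN ->.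
apply: (fB y iy); apply: (@strip_interior _ _ _ _ _ a (dot a v) p) => //; last exact: VW.
by move=> x Wx; apply: SB; rewrite SH.
Qed.

Lemma full_dim_polyhedron_maximal S d d' : polyhedron_in W S ->
  has_dim S d -> has_dim W d -> maximal_lattice_free_convex V (S `&` V) ->
  has_dim (S `&` V) d' ->
  set_bij (facets S) (facets (S `&` V)) (fun F => F `&` V) ->
  maximal_lattice_free_convex W S.
Proof.
move=> [m [a [b SE]]] dS dW maxC dC [fV fI _].
have [J [_ PJ irr]] := irredundant_subset z0 M a b [set: 'I_m].
have {}SE : S = polyhedron z0 M a b J.
  rewrite SE PJ; apply/seteqP; split => x [Wx h]; split => // i; last exact: h.
have SW : S `<=` W by rewrite SE; exact: polyhedron_sub.
have cS : convex_set S by rewrite SE; exact: polyhedron_convex.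
have hS : affine_hull S = W by rewrite (has_dim_hull_eq SW dS dW) affine_hull_translate.
have [x1 Ix1] := full_dim_interior cS hS.
have Wx1 := SW _ (interior_in_sub Ix1).
have Px1 : polyhedron z0 M a b J x1 by rewrite -SE; exact: interior_in_sub Ix1.
have strict i : i \in J -> dot (a i) x1 < b i.
  move=> iJ; apply: interior_lt SW _ (irredundant_direction Px1 irr iJ) Ix1.
  by move=> y; rewrite SE => -[_]; exact.
have fS := facets_polyhedron irr Wx1 strict; rewrite -SE in fS.
have FS i : i \in J -> facets S (polyhedron_face z0 M a b J i).
  by move=> iJ; rewrite fS; exists i.
have [/lattice_freeP[CV cC fC] mC] := maxC.
have SVP : S `&` V `<=` polyhedron z0 M a b J by rewrite -SE => x [].
(* A point of the trace on [V] strict for all inequalities: otherwise the trace of some facet would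
   be the whole trace of [S], and could not be one of its facets. *)
have [i iJ|x0 [Sx0 Vx0] sx0] := convex_strict_point cC (has_dim_nonempty dC) SVP.
  apply: contrapT => H.
  have FV : polyhedron_face z0 M a b J i `&` V = S `&` V.
    rewrite SE; apply/seteqP; split => x [] Fx Vx; split => //; first by case: Fx.
    split => //; apply/eqP; rewrite eq_le; apply/andP; split.
      by case: Fx => _; exact.
    rewrite leNgt; apply/negP => xi; apply: H; exists x => //; split => //.
    by rewrite SE.
  have := fV _ (FS i iJ); rewrite FV => -[_ [e [h1 h2]]].
  by have /eqP := has_dim_uniq h1 h2; rewrite gtn_eqF.
have Ix0 : interior_in W S x0 by rewrite SE; apply: strict_interior => //; exact: VW.
split.
  apply/lattice_freeP; split => // y iy Iy.
  have Vy : V y by apply: ZV => //; exact: SW (interior_in_sub Iy).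
  exact: (fC y iy) (interior_restrict Iy Vy).
move=> B /lattice_freeP[BW cB fB] SB; apply/seteqP; split => // p Bp.
have Wp := BW _ Bp.
rewrite SE; split => // i iJ; rewrite leNgt; apply/negP => pi.
have IB0 : interior_in W B x0 by exact: interior_mono (VW Vx0) SB Ix0.
(* The trace of [B] is lattice-free because [interior_extend] lifts its interior points to [B];
   maximality in [V] applies. *)
have BC : B `&` V = S `&` V.
  apply: mC; last by move=> x [Sx Vx]; split => //; exact: SB.
  apply/lattice_freeP; split.
  - by move=> x [].
  - apply/convexP => x y t [Bx Vx] [By Vy] t0 t1; split; last exact: translate_conv.
    by move/convexP: cB; apply.
  by move=> y iy /(interior_extend BW cB IB0 Vx0); exact: fB.
pose F j := polyhedron_face z0 M a b J j `&` V.
have [_ [e [dCe dFe]]] := fV _ (FS i iJ).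
have Fdim j : j \in J -> has_dim (F j) e.
  move=> jJ; have [_ [e' [dCe' dFe']]] := fV _ (FS j jJ).
  by have [->] := has_dim_uniq dCe dCe'.
have cF : convex_set (F i).
  apply/convexP => x y t [[Px /= xi] Vx] [[Py /= yi] Vy] t0 t1; split; last exact: translate_conv.
  split; first by move/convexP: (@polyhedron_convex _ _ z0 M _ a b J); apply.
  by rewrite /= !dotE xi yi -mulrDl addrC subrK mul1r.
have FP : F i `<=` polyhedron z0 M a b (J :\ i).
  move=> x [[[Wx h] _] _]; split => // j; rewrite in_setD1 => /andP[_]; exact: h.
(* A point of the trace of facet [i] strict for all other inequalities: otherwise this trace lies in
   that of some facet [j], equals it by dimension, and injectivity of the correspondence gives
   [i = j]. *)
have [j|x Fx sx] := convex_strict_point cF (has_dim_nonempty dFe) FP.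
  rewrite in_setD1 => /andP[ji jJ]; apply: contrapT => H.
  have Fij : F i `<=` F j.
    move=> x Fx; have [[Px xi] Vx] := Fx; split => //; split => //=.
    apply/eqP; rewrite eq_le; apply/andP; split; first by case: Px => _; exact.
    by rewrite leNgt; apply/negP => xj; apply: H; exists x.
  have Fji : F j `<=` F i.
    move=> x Fx; have [[Px _] Vx] := Fx; split => //; split => //=.
    apply: (@affine_hull_eq_dot _ _ (F i) (a i)); first by move=> y [[]].
    rewrite (has_dim_hull_eq Fij dFe (Fdim j jJ)); exact: sub_affine_hull.
  have Fe : polyhedron_face z0 M a b J i = polyhedron_face z0 M a b J j.
    apply: fI; rewrite ?inE; [exact: FS|exact: FS|].
    by apply/seteqP; split.
  have ij : i = j by apply: (polyhedron_face_inj irr Wx1 strict iJ jJ); rewrite Fe.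
  by move: ji; rewrite ij eqxx.
have [[Px /= xi] Vx] := Fx; have Wx := VW Vx.
have [d1 d10 hd] := strict_push (x - p) sx.
(* Moving from [x] away from [p] makes inequality [i] strict and, for a short step, keeps the others
   strict; [x] is then between an interior point of [S] and the point [p] of [B]. *)
have Iq : interior_in W B (x + d1 *: (x - p)).
  apply: (@interior_mono _ _ _ S) => //.
    by apply: translateD => //; rewrite memvZ// (translateB Wx Wp).
  rewrite SE; apply: strict_interior.
    by apply: translateD => //; rewrite memvZ// (translateB Wx Wp).
  move=> j jJ; have [->|ji] := eqVneq j i.
    rewrite !dotE xi gtrDl pmulr_rlt0// subr_lt0//.
  by apply: hd; [rewrite in_setD1 ji|rewrite gtr0_norm].
have d11 : 0 < 1 + d1 by rewrite addr_gt0.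
have IBx : interior_in W B x.
  have -> : x = (x + d1 *: (x - p)) + (d1 / (1 + d1)) *: (p - (x + d1 *: (x - p))).
    by apply/rowP => k; rewrite !mxE; field; rewrite gt_eqF.
  apply: interior_convex_step => //.
  by rewrite divr_ge0 ?(ltW d10) ?(ltW d11)//= ltr_pdivrMr// mul1r ltrDr.
have := interior_restrict IBx Vx; rewrite BC => ICx.
have : dot (a i) x < b i.
  apply: (interior_lt CV) ICx; first by move=> y [+ _]; rewrite SE => -[_]; exact.
  exists (x - x0); first exact: translateB Vx Vx0.
  by rewrite dotBr xi gt_eqF// subr_gt0 sx0.
by rewrite xi ltxx.
Qed.

(** Lattice vectors of [K] bring every integral point of [V] with level between [c] and [c + 1] into
    a fixed ball without changing its level, so only finitely many such levels occur. *)
Lemma hyperplane_gap a c (K : {vspace E}) : (exists2 u, u \in N & dot a u != 0) ->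
  (forall x, x \in K <-> x \in N /\ dot a x = 0) ->
  [set` K] = linear_span ([set` K] `&` integral_points) ->
  exists2 d : R, 0 < d & forall y, integral_points y -> V y -> c < dot a y -> c + d <= dot a y.
Proof.
move=> [u0 u0N au0] KE rat.
have [u [uN au]] : exists u, u \in N /\ dot a u = 1.
  by exists ((dot a u0)^-1 *: u0); rewrite memvZ// dotZr mulVf.
have [X [XK KX]] := finite_generation ([set` K] `&` integral_points).
have KX' x : x \in K -> x \in <<X>>%VS.
  move=> xK; have : [set` K] x by [].
  rewrite rat => -[k [d [p [pK ->]]]]; apply: memv_suml => i _; rewrite memvZ//; exact: KX.
have aX (i : 'I_(size X)) : dot a X`_i = 0 /\ integral_points X`_i.
  by have [/KE[_ ->] ix] := XK _ (mem_nth 0 (ltn_ord i)).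
(* A bound for the norm of the reduced point [y'] below. *)
pose m := `|z0| + (`|c| + 1 + `|dot a z0|) * `|u| + \sum_(i < size X) `|X`_i|.
have [s sP] := @integral_bounded R n m.
(* [uniform_radius] serves to bound from below the finitely many positive excesses over [c]. *)
have [z _|d d0 hd] := @uniform_radius R E s (fun z t => c < dot a z -> c + `|t| <= dot a z).
  have [cz|cz] := ltP c (dot a z); last by exists 1.
  exists (dot a z - c); first by rewrite subr_gt0.
  by move=> t ht _; lra.
exists (Num.min d 1); first by rewrite lt_min d0 ltr01.
have md : `|Num.min d 1| <= d by rewrite ger0_norm ?ge_min ?lexx// le_min ltW//= ler01.
have m0 : `|Num.min d 1| = Num.min d 1 by rewrite ger0_norm// le_min ltW//= ler01.
have m1 : Num.min d 1 <= 1 by rewrite ge_min lexx orbT.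
move=> y iy Vy cy; have [y1|y1] := leP (c + 1) (dot a y); first by apply: le_trans y1; lra.
have kK : y - z0 - (dot a y - dot a z0) *: u \in K.
  apply/KE; split; first by rewrite memvB ?memvZ// (translateB Vy (translate_base _ _)).
  by rewrite !dotE au mulr1 subrr.
have /span_coordP[b bE] := KX' _ kK.
pose y' := y - \sum_(i < size X) ((Num.floor (b i))%:~R : R) *: X`_i.
have ay' : dot a y' = dot a y.
  by rewrite dotBr dot_sumr big1 ?subr0// => i _; rewrite dotZr (aX i).1 mulr0.
rewrite -ay' -m0; apply: (hd y') => //; last by rewrite ay'.
apply: sP.
  by apply: integralB => //; apply: integral_sum => i; apply: integralZ; exact: (aX i).2.
have -> : y' = z0 + (dot a y - dot a z0) *: u -
    \sum_(i < size X) ((Num.floor (b i))%:~R - b i) *: X`_i.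
  rewrite (eq_bigr (fun i : 'I_(size X) =>
    ((Num.floor (b i))%:~R : R) *: X`_i - b i *: X`_i)) => [|i _]; last by rewrite scalerBl.
  by rewrite sumrB -bE /y'; vec.
apply: le_trans (ler_normB _ _) _; rewrite lerD//.
  apply: le_trans (ler_normD _ _) _; rewrite lerD2l normrZ ler_wpM2r//.
  apply: le_trans (ler_normB _ _) _; rewrite lerD2r.
  rewrite ler_norml; have := ler_norm c; have := ler_norm (- c); rewrite normrN => h1 h2.
  by apply/andP; split; lra.
apply: le_trans (ler_norm_sum _ _ _) _; apply: ler_sum => i _; rewrite normrZ.
by rewrite -[leRHS]mul1r ler_wpM2r// floor_dist.
Qed.

(** * Structure of a maximal lattice-free set of [W] *)

Section Maximal.
Variable S : set E.
Hypothesis maxS : maximal_lattice_free_convex W S.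

Let SW : S `<=` W. Proof. by case: maxS => -[]. Qed.
Let cS : convex_set S. Proof. by case: maxS => -[]. Qed.
Let fS y : integral_points y -> ~ interior_in W S y.
Proof. by case: maxS => /lattice_freeP[_ _ h] _; exact: h. Qed.

Let maxE B : B `<=` W -> convex_set B -> S `<=` B ->
  (forall y, integral_points y -> V y -> ~ interior_in W B y) -> B = S.
Proof.
case: maxS => _ max BW cB SB fB; apply: max => //; apply/lattice_freeP; split => //.
by move=> y iy Iy; apply: (fB y iy) => //; apply: ZV => //; exact: BW (interior_in_sub Iy).
Qed.

(** Separation encloses [S] in a half-space with [V] on its bounding hyperplane. All integral points
    lie there, so the half-space is lattice-free and equals [S]. *)
Lemma maximal_half_space x1 : interior_in W S x1 ->
  (forall x, V x -> ~ interior_in W S x) ->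
  closed_half_space_of W S /\ V `<=` boundary_in W S.
Proof.
move=> Ix1 noI.
have [|a [aN aS aI]] := affine_separation SW cS Ix1 NM.
  by move=> x xN; apply: noI; exact: translateD (translate_base _ _) xN.
have aV x : V x -> dot a x = dot a z0.
  by move=> /translateP/aN; rewrite dotBr => /eqP; rewrite subr_eq0 => /eqP.
have nca : exists2 u, u \in M & dot a u != 0.
  exists (z0 - x1); last by rewrite dotBr gt_eqF// subr_gt0 aI.
  exact: translateB (translate_base _ _) (SW (interior_in_sub Ix1)).
have SE : W `&` [set x | dot a x <= dot a z0] = S.
  apply: maxE => //.
  - exact: half_space_convex.
  - by move=> x Sx; split; [exact: SW|exact: aS].
  move=> y iy Vy Iy; suff : dot a y < dot a z0 by rewrite aV// ltxx.
  by apply: interior_lt nca Iy => x [].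
split; first by exists a, (dot a z0); split; [exact: hyperplane_level_of|].
move=> x Vx; split; last exact: noI.
by apply: (@subset_closure (subspace W)); rewrite -SE; split; [exact: VW|rewrite /= aV].
Qed.

(** The convex join of [S] with a lattice-free [C] containing the trace of [S] meets [V] only in
    [C]. It is therefore lattice-free and equal to [S]. *)
Lemma maximal_restrict x0 : interior_in W S x0 -> V x0 ->
  maximal_lattice_free_convex V (S `&` V).
Proof.
move=> Ix0 Vx0; split.
  apply/lattice_freeP; split; first by move=> x [].
    apply/convexP => x y t [Sx Vx] [Sy Vy] t0 t1; split; last exact: translate_conv.
    by move/convexP: cS; apply.
  by move=> y iy /(interior_extend SW cS Ix0 Vx0); exact: fS.
move=> C /lattice_freeP[CV cC fC] SC; apply/seteqP; split => // x Cx.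
have CJ : C `<=` convex_join S C.
  move=> y Cy; exists x0, y, 0; split => //; first exact: interior_in_sub Ix0.
    by rewrite lexx ler01.
  by rewrite scale0r add0r subr0 scale1r.
have JV : convex_join S C `&` V `<=` C.
  move=> _ [[s [y [t [Ss Cy /andP[t0 t1] ->]]]] Vx].
  (* For nonzero [t], the point [s] is an affine combination of two points of [V], so it lies in the
     trace of [S] and hence in [C]. *)
  have [t00|tn] := eqVneq t 0.
    by rewrite t00 scale0r add0r subr0 scale1r.
  move/convexP: cC; apply => //; apply: SC; split => //.
  have -> : s = y + t^-1 *: (t *: s + (1 - t) *: y - y).
    by apply/rowP => k; rewrite !mxE; field.
  by apply: translateD; [exact: CV|rewrite memvZ// (translateB Vx)//; exact: CV].
have JE : convex_join S C = S.
  apply: maxE.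
  - move=> _ [s [y [t [Ss Cy _ ->]]]]; apply: translate_conv; first exact: SW.
    by apply: VW; exact: CV.
  - exact: convex_join_convex.
  - move=> s Ss; exists s, x, 1; split => //; first by rewrite ler01 lexx.
    by rewrite scale1r subrr scale0r addr0.
  move=> y iy Vy Iy; apply: (fC y iy).
  exact: interior_mono Vy JV (interior_restrict Iy Vy).
by split; [rewrite -JE; exact: CJ|exact: CV].
Qed.

(** The functionals used in [V] bound all of [S]. The polyhedron that finitely many of them cut out
    in [W] contains [S] and has the same trace on [V], so it is lattice-free and equals [S]. *)
Lemma maximal_polyhedron x0 : interior_in W S x0 -> V x0 ->
  [/\ polyhedron_in W S,
      exists d, has_dim S d /\ has_dim W d,
      maximal_lattice_free_convex V (S `&` V),
      exists d, has_dim (S `&` V) d /\ has_dim V d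
    & set_bij (facets S) (facets (S `&` V)) (fun F => F `&` V)].
Proof.
move=> Ix0 Vx0; have maxC := maximal_restrict Ix0 Vx0.
have ICx0 := interior_restrict Ix0 Vx0.
have aP z : exists a, integral_points z -> V z ->
    (forall s, S s -> dot a s <= dot a z) /\ dot a x0 < dot a z.
  have [[iz Vz]|H] := pselect (integral_points z /\ V z); last first.
    (* Points that are not integral points of [V] get the dummy functional 0. *)
    by exists 0 => iz Vz; case: H.
  have e := translate_rebase (VW Vz).
  have SW' : S `<=` translate z M by rewrite -e.
  have Ix0' : interior_in (translate z M) S x0 by rewrite -e.
  have [|a [_ aS aI]] := affine_separation SW' cS Ix0' (sub0v M).
    by move=> x; rewrite memv0 => /eqP ->; rewrite addr0 -e; exact: fS.
  by exists a => _ _; split => //; exact: aI.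
pose a z := sval (cid (aP z)).
have aS z : integral_points z -> V z -> forall s, S s -> dot (a z) s <= dot (a z) z.
  by move=> iz Vz; rewrite /a; case: cid => ? /= /(_ iz Vz)[].
have ax0 z : integral_points z -> V z -> dot (a z) x0 < dot (a z) z.
  by move=> iz Vz; rewrite /a; case: cid => ? /= /(_ iz Vz)[].
have aC z : integral_points z -> V z -> forall s, (S `&` V) s -> dot (a z) s <= dot (a z) z.
  by move=> iz Vz s [Ss _]; exact: aS.
have [s [sV TE]] := finite_support_polyhedron sN maxC ICx0 aC ax0.
pose I := 'I_(size s); pose f (i : I) := a s`_i; pose g (i : I) := dot (f i) s`_i.
have sI (i : I) : integral_points s`_i /\ V s`_i by exact/sV/mem_nth.
have [J [_ PJ irr]] := irredundant_subset z0 N f g [set: I].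
have CE : S `&` V = polyhedron z0 N f g J.
  rewrite PJ -TE; apply/seteqP; split => x [Vx h]; split => //.
    by move=> i _; apply: h; exact: mem_nth.
  move=> z /= zs; have zi : (index z s < size s)%N by rewrite index_mem.
  by have := h (Ordinal zi) (finset.in_setT _); rewrite /g /f /= nth_index.
(* Witnesses of irredundancy in [V] are also witnesses in [W], so the same indices number the facets
   of both polyhedra. *)
have irrW : irredundant z0 M f g J.
  by move=> i /irr[y [Vy yi yj]]; exists y; split => //; exact: VW.
have PV : polyhedron z0 M f g J `&` V = S `&` V.
  rewrite CE; apply/seteqP; split => x; first by move=> [[_ h] Vx]; split.
  by move=> [Vx h]; split => //; split => //; exact: VW.
have SE : S = polyhedron z0 M f g J.
  apply/esym/maxE.
  - exact: polyhedron_sub.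
  - exact: polyhedron_convex.
  - move=> x Sx; split; first exact: SW.
    by move=> i _; have [iz Vz] := sI i; exact: aS.
  move=> y iy Vy Iy; have [/lattice_freeP[_ _ fC] _] := maxC.
  by apply: (fC y iy); rewrite -PV; exact: interior_restrict.
have strict i : i \in J -> dot (f i) x0 < g i by move=> _; have [iz Vz] := sI i; exact: ax0.
split => //.
- exists #|J|, (fun k => f (enum_val k)), (fun k => g (enum_val k)).
  rewrite {1}SE; apply/seteqP; split => x [Wx h]; split => //.
    by move=> k; apply: h; exact: enum_valP.
  by move=> i iJ; have := h (enum_rank_in iJ i); rewrite enum_rankK_in.
- exists (\dim M); split; last exact: has_dim_translate.
  by rewrite SE; apply: polyhedron_dim (VW Vx0) strict.
- exists (\dim N); split; last exact: has_dim_translate.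
  by rewrite CE; apply: polyhedron_dim Vx0 strict.
have fSE := facets_polyhedron irrW (VW Vx0) strict; rewrite -SE in fSE.
have fCE := facets_polyhedron irr Vx0 strict; rewrite -CE in fCE.
have FV i : polyhedron_face z0 M f g J i `&` V = polyhedron_face z0 N f g J i.
  rewrite /polyhedron_face -setIA (setIC _ V) setIA PV CE //.
split.
- by move=> F; rewrite fSE fCE => -[i iJ <-]; exists i.
- move=> F F'; rewrite fSE !inE => -[i iJ <-] [j jJ <-] /=; rewrite !FV => FF.
  by have -> : i = j by apply: (polyhedron_face_inj irr Vx0 strict iJ jJ); rewrite FF.
move=> F; rewrite fSE fCE => -[i iJ <-]; exists (polyhedron_face z0 M f g J i) => //.
by exists i.
Qed.

(** A convex set with empty interior lies in a level set of a nonconstant functional; this level set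
    has empty interior too, so it is lattice-free. *)
Lemma maximal_flat : (forall x, ~ interior_in W S x) ->
  ((exists w, W = [set w]) -> S !=set0) ->
  exists a c, (exists2 u, u \in M & dot a u != 0) /\ S = W `&` [set x | dot a x = c].
Proof.
move=> noI nd.
have [a [c [nca Sc]]] : exists a c, (exists2 u, u \in M & dot a u != 0) /\
    forall x, S x -> dot a x = c.
  (* An empty [S] lies in every level set, and [nd] then ensures that [M] is nonzero and carries a
     nonconstant functional. *)
  have [[b Sb]|S0] := pselect (S !=set0); last first.
    have M0 : M != 0%VS.
      apply/eqP => M0; apply/S0/nd; exists z0; apply/seteqP; split => x.
        by move/translateP; rewrite M0 memv0 subr_eq0 => /eqP ->.
      by move=> ->; exact: translate_base.
    have [|a [_ au]] := @separating_functional _ _ 0%VS (vpick M).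
      by rewrite memv0 vpick0.
    exists a, 0; split; first by exists (vpick M); rewrite ?memv_pick// au oner_neq0.
    by move=> x Sx; case: S0; exists x.
  have [X [XS hX]] := affine_hull_span Sb.
  have e := translate_rebase (SW Sb).
  have [MX|/subvPn[u uM uX]] := boolP (M <= <<X>>)%VS.
    have XM : (<<X>> <= M)%VS.
      apply/span_subvP => x /XS Sbx; have := translateB (SW Sbx) (SW Sb).
      by rewrite addrC addKr.
    have XE : <<X>>%VS = M by apply/eqP; rewrite eqEsubv XM.
    rewrite XE -e in hX; have [x Ix] := full_dim_interior cS hX.
    by case: (noI x).
  have [a [aX au]] := separating_functional uX.
  exists a, (dot a b); split; first by exists u; rewrite // au oner_neq0.
  move=> x /sub_affine_hull; rewrite hX => /translateP/aX; rewrite dotBr => /eqP.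
  by rewrite subr_eq0 => /eqP.
exists a, c; split => //; apply/esym/maxE.
- by move=> x [].
- by have [w [L [_ _ -> _ _]]] := hyperplane_level z0 c nca; exact: translate_convex.
- by move=> x Sx; split; [exact: SW|exact: Sc].
move=> y _ _ Iy; have : dot a y < c by apply: interior_lt nca Iy => x [] // _ /= ->.
by have [_ /= ->] := interior_in_sub Iy; rewrite ltxx.
Qed.

(** Otherwise [V] lies on a single level, and the half-space bounded by that level on the side of
    [S] is lattice-free and strictly larger than [S]. Changing the sign of [a] reduces to one
    side. *)
Lemma maximal_flat_nonconstant a c : (exists2 u, u \in M & dot a u != 0) ->
  S = W `&` [set x | dot a x = c] -> exists2 u, u \in N & dot a u != 0.
Proof.
move=> nca SE; apply: contrapT => H.
have aN x : x \in N -> dot a x = 0.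
  by move=> xN; apply/eqP; apply: contrapT => /negP ax; apply: H; exists x.
have key a' c' : (exists2 u, u \in M & dot a' u != 0) ->
    S = W `&` [set x | dot a' x = c'] -> (forall x, x \in N -> dot a' x = 0) ->
    c' <= dot a' z0 -> False.
  move=> nca' SE' aN' cz.
  have BE : W `&` [set x | dot a' x <= dot a' z0] = S.
    apply: maxE; first by move=> x [].
    - exact: half_space_convex.
    - by rewrite SE' => x [Wx /= ->].
    move=> y iy Vy Iy; have : dot a' y < dot a' z0 by apply: interior_lt nca' Iy => x [].
    have /eqP := aN' _ (translateB Vy (translate_base _ _)).
    by rewrite dotBr subr_eq0 => /eqP ->; rewrite ltxx.
  have [w [_ [Ww wc _ _ _]]] := hyperplane_level z0 (c' - 1) nca'.
  have : S w by rewrite -BE; split => //=; rewrite wc; lra.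
  by rewrite SE' => -[_ /=]; rewrite wc; lra.
have [cz|cz] := leP c (dot a z0); first exact: key nca SE aN cz.
apply: (key (- a) (- c)).
- by case: nca => u uM au; exists u => //; rewrite dotNl oppr_eq0.
- rewrite SE; apply/seteqP; split=> x [Wx /= ax]; split => //=; first by rewrite dotNl ax.
  by move: ax; rewrite dotNl => /oppr_inj.
- by move=> x /aN ax; rewrite dotNl ax oppr0.
- by rewrite dotNl lerN2 ltW.
Qed.

Lemma maximal_hyperplane : (forall x, ~ interior_in W S x) ->
  ((exists w, W = [set w]) -> S !=set0) ->
  affine_hyperplane_of W S /\
  exists v L (V0 : {vspace E}), [/\ S v, S = translate v L,
    [set` V0] = [set x - y | x in V & y in V]
    & irrational_hyperplane_of V0 (L :&: V0)%VS].
Proof.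
move=> noI nd; have [a [c [nca SE]]] := maximal_flat noI nd.
have ncN := maximal_flat_nonconstant nca SE.
split; first by rewrite SE; exact: hyperplane_level_of.
have [w [L [Ww wc HE LE dL]]] := hyperplane_level z0 c nca.
exists w, L, N; split.
- by rewrite SE; split.
- by rewrite SE HE.
- apply/seteqP; split => x.
    move=> xN; exists (z0 + x); first exact: translateD (translate_base _ _) xN.
    by exists z0; [exact: translate_base|rewrite addrC addKr].
  by move=> [y Vy [y' Vy' <-]]; exact: translateB Vy Vy'.
have [K [KE dK]] := hyperplane_dim ncN.
have KL : (L :&: N)%VS = K.
  apply/vspaceP => x; rewrite memv_cap; apply/idP/idP.
    by move=> /andP[/LE[_ ax] xN]; apply/KE.
  by move/KE => [xN ax]; rewrite xN andbT; apply/LE; split => //; exact: (subvP NM).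
rewrite KL; split => //; first by rewrite -KL capvSr.
(* In the rational case the slab between the levels [c] and [c + d] has no integral point in its
   interior, yet strictly contains [S]. *)
move=> rat; have [d d0 gap] := hyperplane_gap c ncN KE rat.
have BE : W `&` [set x | dot (- a) x <= - c] `&` [set x | dot a x <= c + d] = S.
  apply: maxE.
  - by move=> x [[]].
  - apply/convexP => x y t [Bx /= xd] [By /= yd] t0 t1; split.
      by move/convexP: (half_space_convex (v := z0) (L := M) (a := - a) (c := - c)); apply.
    rewrite /= !dotE; have t1' : 0 <= 1 - t by rewrite subr_ge0.
    have := ler_wpM2l t0 xd; have := ler_wpM2l t1' yd; lra.
  - move=> x; rewrite SE => -[Wx /= xc]; split; first by split => //=; rewrite dotNl xc.
    by rewrite /= xc lerDl ltW.
  move=> y iy Vy Iy.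
  have BW : W `&` [set x | dot (- a) x <= - c] `&` [set x | dot a x <= c + d] `<=` W.
    by move=> x [[]].
  have y1 : dot a y < c + d by apply: interior_lt BW _ nca Iy => x [].
  have y2 : dot (- a) y < - c.
    apply: interior_lt BW _ _ Iy; first by move=> x [[]].
    by case: nca => u uM au; exists u => //; rewrite dotNl oppr_eq0.
  by move: y2; rewrite dotNl ltrN2 => /(gap y iy Vy); lra.
have [x [_ [Wx xc _ _ _]]] := hyperplane_level z0 (c + d) nca.
have : S x by rewrite -BE; split; [split => //=; rewrite dotNl|]; rewrite /= xc; lra.
by rewrite SE => -[_ /=]; rewrite xc; lra.
Qed.

End Maximal.

End Main.

(** [ndS] excludes one degenerate case: if [W] is a single integral point, the empty set is maximal
    lattice-free but satisfies none of the three conditions. *)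
Theorem theorem1 (R : realType) (n : nat) (W V S : set 'rV[R]_n)
  (affW : affine_subspace W)
  (intW : (W `&` integral_points) !=set0)
  (defV : V = affine_hull (W `&` integral_points))
  (subS : S `<=` W)
  (ndS : (exists w, W = [set w]) -> S !=set0) :
  maximal_lattice_free_convex W S <->
  [\/ [/\ polyhedron_in W S,
          exists d, has_dim S d /\ has_dim W d,
          maximal_lattice_free_convex V (S `&` V),
          exists d, has_dim (S `&` V) d /\ has_dim V d
        & set_bij (facets S) (facets (S `&` V)) (fun F => F `&` V)],
      affine_hyperplane_of W S /\
      (exists (v : 'rV[R]_n) (L V0 : {vspace 'rV[R]_n}),
        [/\ S v, S = translate v L,
            [set` V0] = [set x - y | x in V & y in V]
          & irrational_hyperplane_of V0 (L :&: V0)%VS])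
    | closed_half_space_of W S /\ V `<=` boundary_in W S].
Proof.
have [v [M WE]] := affW; have [z0 [Wz0 iz0]] := intW.
rewrite {}WE in affW intW defV subS ndS Wz0 *.
have e := translate_rebase Wz0; rewrite {}e {v} in affW intW defV subS ndS Wz0 *.
(* With the integral point [z0] as origin, [V] becomes [z0 + N], where [N] is spanned by differences
   of integral points. *)
have [X [XW hX]] := affine_hull_span (conj Wz0 iz0 : (translate z0 M `&` integral_points) z0).
rewrite hX in defV; rewrite {}defV; set N := <<X>>%VS.
have sN : spanned_by_integral N.
  exists X => // x /XW[_ ix]; have -> : x = (z0 + x) - z0 by vec.
  exact: integralB.
have NM : (N <= M)%VS.
  apply/span_subvP => x /XW[Wx _]; have := translateB Wx Wz0.
  by rewrite addrC addKr.
have ZV y : integral_points y -> translate z0 M y -> translate z0 N y.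
  by move=> iy Wy; rewrite -hX; apply: sub_affine_hull.
split=> [maxS|[[polS [d [dS dW]] maxC [d' [dC _]] bij]|[hS [v [L [V0 [Sv SE V0E irr]]]]]|[hS VS]]].
(* The case is decided by the interior of [S]: empty, meeting [V], or nonempty and missing [V]. *)
- have [[x Ix]|noI] := pselect (exists x, interior_in (translate z0 M) S x); last first.
    by apply: Or32; apply: maximal_hyperplane ndS => // x Ix; apply: noI; exists x.
  have [[x0 [Ix0 Vx0]]|noV] :=
      pselect (exists x0, interior_in (translate z0 M) S x0 /\ translate z0 N x0).
    by apply: Or31; exact: maximal_polyhedron Ix0 Vx0.
  apply: Or33; apply: (maximal_half_space NM ZV maxS Ix) => x0 Vx0 Ix0.
  by apply: noV; exists x0.
- exact: full_dim_polyhedron_maximal polS dS dW maxC dC bij.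
- have V0N : V0 = N.
    apply/vspaceP => x; apply/idP/idP => xV.
      have : [set` V0] x by []; rewrite V0E => -[y Vy [y' Vy' <-]]; exact: translateB Vy Vy'.
    suff : [set` V0] x by [].
    rewrite V0E; exists (z0 + x); first exact: translateD (translate_base _ _) xV.
    by exists z0; [exact: translate_base|rewrite addrC addKr].
  rewrite V0N in irr; exact: irrational_hyperplane_maximal hS Sv SE irr.
- exact: half_space_maximal hS VS.
Qed.
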